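(* Fix a horizon $T>0$, a dimension $d\ge 1$ and a deterministic start $x_0\in\mathbb{R}^d$. Let $\Gamma_t=(\beta_t,\nu_t,\sigma_t,\kappa_t)$ be a piecewise-constant protocol on a grid $0=t_0<t_1<\dots<t_N=T$, i.e. on each interval $[t_j,t_{j+1})$ one has $\beta_t=\beta_j$ symmetric positive definite in $\mathbb{R}^{d\times d}$, $\nu_t=\nu_j\in\mathbb{R}^d$, $\sigma_t=\sigma_j\in\mathbb{R}^{d\times d}$ arbitrary, and $\kappa_t=\kappa_j>0$ a scalar. Set $V_t(x)=\tfrac12(x-\nu_t)^\top\beta_t(x-\nu_t)$, and let the target be the Gaussian mixture $p^{(\mathrm{tar})}(y)=\sum_{k=1}^K\pi_k\,\mathcal N(y;m_k,\Sigma_k)$ with $\pi_k>0$, $\sum_k\pi_k=1$, $\Sigma_k\succ 0$, $P_k=\Sigma_k^{-1}$. Consider the controlled SDE $dX_t=(\sigma_tX_t+u_t(X_t))\,dt+\sqrt{\kappa_t}\,dW_t$, $X_0=x_0$, with the endpoint-constrained optimal control problem described in the context, whose optimal drift is $u^*_t(x)=\kappa_t\nabla_x\log\psi_t(x)$ and optimal marginal is $p^*_t(x)\propto G^{(+)}_t(x\mid x_0)\,\psi_t(x)$, where $$\psi_t(x)\propto\int_{\mathbb{R}^d}\frac{p^{(\mathrm{tar})}(y)\,G^{(-)}_t(x\mid y)}{G^{(+)}_T(y\mid x_0)}\,dy .$$ Write the Green functions in the Gaussian-exponential form $$G^{(\pm)}_t(x\mid y)=\exp\!\Big(-\tfrac12x^\top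 A^{(\pm)}_tx+x^\top B^{(\pm)}_ty-\tfrac12y^\top C^{(\pm)}_ty+(\theta^{(\pm)}_{x;t})^\top x+(\theta^{(\pm)}_{y;t})^\top y+\zeta^{(\pm)}_t\Big),$$ with $A^{(\pm)}_t,C^{(\pm)}_t$ symmetric, and write $\zeta^{(+)}_T(x_0)$ for the sum of all $y$-independent terms in $\log G^{(+)}_T(y\mid x_0)$. For $t\in(0,T)$ and $k=1,\dots,K$ define $$S_{k,t}=C^{(-)}_t+P_k-A^{(+)}_T,\qquad q_{k,t}=\theta^{(-)}_{y;t}+P_km_k-B^{(+)}_Tx_0-\theta^{(+)}_{x;T},$$ $$\Lambda_{k,t}=A^{(-)}_t-B^{(-)}_tS_{k,t}^{-1}(B^{(-)}_t)^\top,\qquad \lambda_{k,t}=\theta^{(-)}_{x;t}+B^{(-)}_tS_{k,t}^{-1}q_{k,t},$$ $$\omega_{k,t}=\pi_k|\Sigma_k|^{-1/2}|S_{k,t}|^{-1/2}\exp\!\Big(\zeta^{(-)}_t-\zeta^{(+)}_T(x_0)-\tfrac12m_k^\top P_km_k+\tfrac12q_{k,t}^\top S_{k,t}^{-1}q_{k,t}\Big),$$ $\psi_{k,t}(x)=\omega_{k,t}\exp(-\tfrac12x^\top\Lambda_{k,t}x+\lambda_{k,t}^\top x)$ and $\rho_{k,t}(x)=\psi_{k,t}(x)/\sum_{j=1}^K\psi_{j,t}(x)\in(0,1)$. Further define $$\Pi_{k,t}=A^{(+)}_t+\Lambda_{k,t},\quad \mu_{k,t}=\Pi_{k,t}^{-1}\big(B^{(+)}_tx_0+\theta^{(+)}_{x;t}+\lambda_{k,t}\big),$$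 $$\widetilde\omega_{k,t}=\omega_{k,t}|\Pi_{k,t}|^{-1/2}\exp\!\big(\tfrac12\mu_{k,t}^\top\Pi_{k,t}\mu_{k,t}\big),\qquad \bar\pi_{k,t}=\widetilde\omega_{k,t}\Big/\sum_{j=1}^K\widetilde\omega_{j,t}.$$ Then for every $t\in(0,T)$ the optimal drift is $$u^*_t(x)=\kappa_t\sum_{k=1}^K\rho_{k,t}(x)\big(-\Lambda_{k,t}x+\lambda_{k,t}\big),$$ and the optimal marginal density is the Gaussian mixture $$p^*_t(x)=\sum_{k=1}^K\bar\pi_{k,t}\,\mathcal N\!\big(x;\mu_{k,t},\Pi_{k,t}^{-1}\big).$$
   Context: Setting (LQ-GM-PID). The backward Green function $G^{(-)}_t(x\mid y)$, $t\in[0,T]$, solves $-\partial_tG^{(-)}_t+V_t(x)G^{(-)}_t=(\sigma_tx)\cdot\nabla_xG^{(-)}_t+\tfrac{\kappa_t}{2}\Delta_xG^{(-)}_t$ with terminal condition $G^{(-)}_T(x\mid y)=\delta(x-y)$; the forward Green function $G^{(+)}_t(x\mid y)$ solves $\partial_tG^{(+)}_t+V_t(x)G^{(+)}_t=-\nabla_x\cdot\big((\sigma_tx)G^{(+)}_t\big)+\tfrac{\kappa_t}{2}\Delta_xG^{(+)}_t$ with initial condition $G^{(+)}_0(x\mid y)=\delta(x-y)$. The coefficient functions $A^{(\pm)}_t,B^{(\pm)}_t,C^{(\pm)}_t,\theta^{(\pm)}_{x;t},\theta^{(\pm)}_{y;t},\zeta^{(\pm)}_t$ of the Gaussian-exponential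 representation are the outputs of the associated matrix Riccati/linear ODE system (''Riccati cascade''). The control problem: minimize $\mathbb{E}\big[\int_0^T\big(\tfrac{1}{2\kappa_t}\|u_t(X_t)\|^2+V_t(X_t)\big)dt\big]$ over feedback controls $u$ for the SDE $dX_t=(\sigma_tX_t+u_t(X_t))dt+\sqrt{\kappa_t}\,dW_t$, $X_0=x_0$, subject to the terminal law $X_T\sim p^{(\mathrm{tar})}$ (equivalently, a terminal cost $\phi$ chosen so that the terminal marginal is $p^{(\mathrm{tar})}$); via the Hopf–Cole transform $\psi_t=e^{-J_t}$ of the value function the optimal drift is $u^*_t=\kappa_t\nabla\log\psi_t$ and the optimal marginal factorizes as $p^*_t\propto\varphi_t\psi_t$ with $\varphi_t(x)=G^{(+)}_t(x\mid x_0)$, giving the displayed ratio formula for $\psi_t$. Here $K$ denotes the number of target mixture components (not the number of protocol intervals), and $|\cdot|$ denotes the determinant. *)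

(* Defs.v *)
From HB Require Import structures.
From mathcomp Require Import all_boot all_order all_algebra.
From mathcomp Require Import all_classical all_reals all_analysis.

Set Implicit Arguments.
Unset Strict Implicit.
Unset Printing Implicit Defensive.

Import Order.TTheory GRing.Theory Num.Theory.
Import numFieldNormedType.Exports.

Local Open Scope classical_set_scope.
Local Open Scope ring_scope.

Section Defs.
Variable R : realType.

Definition dotv (d : nat) (u v : 'cV[R]_d) : R := \sum_(i < d) u i 0 * v i 0.
Definition qform (d : nat) (M : 'M[R]_d) (x : 'cV[R]_d) : R := dotv x (M *m x).

Definition symmx (d : nat) (M : 'M[R]_d) : Prop := M^T = M.
Definition posdefmx (d : nat) (M : 'M[R]_d) : Prop :=
  symmx M /\ forall v : 'cV[R]_d, v != 0 -> 0 < qform M v.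

Definition ebasis (d : nat) (i : 'I_d) : 'cV[R]_d := delta_mx i 0.

Definition grad (d : nat) (f : 'cV[R]_d -> R) (x : 'cV[R]_d) : 'cV[R]_d :=
  \col_(i < d) ('D_(ebasis i) f x).
Definition lap (d : nat) (f : 'cV[R]_d -> R) (x : 'cV[R]_d) : R :=
  \sum_(i < d) 'D_(ebasis i) ('D_(ebasis i) f) x.
Definition divg (d : nat) (F : 'cV[R]_d -> 'cV[R]_d) (x : 'cV[R]_d) : R :=
  \sum_(i < d) 'D_(ebasis i) (fun z => F z i 0) x.

(* Lebesgue integral over R^d of a [0,+oo]-valued function, written as the
   iterated one-dimensional Lebesgue integral (equal to the d-dimensional
   Lebesgue integral for nonnegative measurable integrands by Tonelli). *)
Fixpoint intRd (d : nat) : ('cV[R]_d -> \bar R) -> \bar R :=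
  match d with
  | 0 => fun f => f 0
  | d'.+1 => fun f =>
      (\int[@lebesgue_measure R]_(s in setT)
         @intRd d' (fun v : 'cV[R]_d' => f (col_mx (const_mx s : 'cV[R]_1) v)))%E
  end.

Definition gauss_pdf (d : nat) (m : 'cV[R]_d) (S : 'M[R]_d) (y : 'cV[R]_d) : R :=
  (Num.sqrt ((2 * pi) ^+ d * \det S))^-1 * expR (- (qform (invmx S) (y - m)) / 2).

Definition gexp (d : nat) (A B C : 'M[R]_d) (thx thy : 'cV[R]_d) (ze : R)
  (x y : 'cV[R]_d) : R :=
  expR (- qform A x / 2 + dotv x (B *m y) - qform C y / 2
        + dotv thx x + dotv thy y + ze).

End Defs.
Arguments ebasis {R d} i.

(* Main.v *)
Require Import Defs.
From HB Require Import structures.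
From mathcomp Require Import all_boot all_order all_algebra.
From mathcomp Require Import all_classical all_reals all_analysis.
From mathcomp Require Import measurable_realfun ring lra.
Import Order.TTheory GRing.Theory Num.Theory.
Import numFieldNormedType.Exports.
Local Open Scope classical_set_scope.
Local Open Scope ring_scope.

(* Everything reduces to Gaussian integrals once [S_{k,t}] and [Pi_{k,t}] are known to be positive definite.  Write [A+, A-, B, C] for [Ap, Am, Bm, Cm].  Comparing the quadratic parts in the two Green equations yields the Riccati system for these matrices.  Finiteness of the integrals in the delta conditions makes [A+] positive definite near [0] and [A-] near [T], and because [beta > 0] the Riccati flow preserves this forwards, respectively backwards, so [M = A+ + A-] is positive definite on [(0, T)].  The Riccati system makes the Schur complement [C - B^T M^-1 B] constant there, and testing the terminal condition against Gaussians shows that it dominates [A+_T]; hence [S >= P + B^T M^-1 B > 0], and [Pi > 0] follows by completing the square. *)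

(** * Dot products and positive definite matrices *)

(** The bound on [S] is suggested by the Chapman-Kolmogorov identity: the integral over [x] of
    [G+_t(x|x0) G-_t(x|y)] should be [G+_T(y|x0)]. Minus twice the logarithm of the integrand has
    quadratic part [x^T M x - 2 x^T B y + y^T C y]; its minimum over [x], the Schur complement,
    should therefore be [y^T A+_T y]. The identity is not among the hypotheses, so constancy in time
    and the limit at [T] take its place. The coefficients of [G-] are not assumed to have limits at
    [T]; what does have a limit is [C - B^T (A- + D)^-1 B], namely [D], and a comparison with [D]
    slightly below [A+_T] gives the lower bound, which is all that positivity requires. The other
    obstacle is regularity: the hypotheses concern values of the Green functions, not their
    coefficients. Second differences of [log G] isolate the quadratic coefficients and carry over
    both continuity and the differential equations; linear and constant terms, hence [nu] and the
    traces, drop out. *)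

Lemma dotvE {R : realType} {d} (u v : 'cV[R]_d) : dotv u v = (u^T *m v) 0 0.
Proof. by rewrite mxE; apply: eq_bigr => i _; rewrite mxE. Qed.

Lemma dotvC {R : realType} {d} (u v : 'cV[R]_d) : dotv u v = dotv v u.
Proof. by apply: eq_bigr => i _; rewrite mulrC. Qed.

Lemma dotvDr {R : realType} {d} (u v w : 'cV[R]_d) :
  dotv u (v + w) = dotv u v + dotv u w.
Proof. by rewrite !dotvE mulmxDr mxE. Qed.

Lemma dotvDl {R : realType} {d} (u v w : 'cV[R]_d) :
  dotv (u + v) w = dotv u w + dotv v w.
Proof. by rewrite dotvC dotvDr !(dotvC w). Qed.

Lemma dotvZr {R : realType} {d} (a : R) (u v : 'cV[R]_d) :
  dotv u (a *: v) = a * dotv u v.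
Proof. by rewrite !dotvE -scalemxAr mxE. Qed.

Lemma dotvZl {R : realType} {d} (a : R) (u v : 'cV[R]_d) :
  dotv (a *: u) v = a * dotv u v.
Proof. by rewrite dotvC dotvZr dotvC. Qed.

Lemma dotvNr {R : realType} {d} (u v : 'cV[R]_d) : dotv u (- v) = - dotv u v.
Proof. by rewrite -scaleN1r dotvZr mulN1r. Qed.

Lemma dotvNl {R : realType} {d} (u v : 'cV[R]_d) : dotv (- u) v = - dotv u v.
Proof. by rewrite dotvC dotvNr dotvC. Qed.

Lemma dotvBr {R : realType} {d} (u v w : 'cV[R]_d) :
  dotv u (v - w) = dotv u v - dotv u w.
Proof. by rewrite dotvDr dotvNr. Qed.

Lemma dotv0r {R : realType} {d} (u : 'cV[R]_d) : dotv u 0 = 0.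
Proof. by rewrite dotvE mulmx0 mxE. Qed.

Lemma dotv0l {R : realType} {d} (u : 'cV[R]_d) : dotv 0 u = 0.
Proof. by rewrite dotvC dotv0r. Qed.

Lemma dotv_mulmxl {R : realType} {d} (M : 'M[R]_d) (u v : 'cV[R]_d) :
  dotv (M *m u) v = dotv u (M^T *m v).
Proof. by rewrite !dotvE trmx_mul mulmxA. Qed.

Lemma dotv_sym {R : realType} {d} (M : 'M[R]_d) (u v : 'cV[R]_d) :
  symmx M -> dotv u (M *m v) = dotv v (M *m u).
Proof. by move=> sM; rewrite dotvC dotv_mulmxl sM. Qed.

Definition dotvlin := (@dotvDr, @dotvDl, @dotvNr, @dotvNl, @dotvZr, @dotvZl,
  @dotv0r, @dotv0l, @mulmxDr, @mulmxDl, @mulmxN, @mulNmx, @mulmx0, @mul0mx).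

Lemma dotv_ge0 {R : realType} {d} (u : 'cV[R]_d) : 0 <= dotv u u.
Proof. by apply: sumr_ge0 => i _; rewrite -expr2 sqr_ge0. Qed.

Lemma dotv_eq0 {R : realType} {d} (u : 'cV[R]_d) : dotv u u = 0 -> u = 0.
Proof.
move/eqP; rewrite psumr_eq0; last by move=> i _; rewrite -expr2 sqr_ge0.
move/allP => h; apply/matrixP => i j; rewrite ord1 mxE.
by have := h i; rewrite mem_index_enum -expr2 sqrf_eq0 => /(_ isT)/eqP.
Qed.

Lemma dotv_gt0 {R : realType} {d} (u : 'cV[R]_d) : u != 0 -> 0 < dotv u u.
Proof.
move=> u0; rewrite lt0r dotv_ge0 andbT; apply: contra u0 => /eqP.
by move/dotv_eq0 ->.
Qed.

Lemma dotv_ebasis {R : realType} {d} (i : 'I_d) (v : 'cV[R]_d) :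
  dotv (ebasis i) v = v i 0.
Proof.
rewrite /dotv (bigD1 i) //= !mxE !eqxx mul1r big1 ?addr0 // => j ji.
by rewrite mxE (negbTE ji) mul0r.
Qed.

Lemma qform0 {R : realType} {d} (M : 'M[R]_d) : qform M 0 = 0.
Proof. by rewrite /qform dotv0l. Qed.

Lemma qformN {R : realType} {d} (M : 'M[R]_d) x : qform M (- x) = qform M x.
Proof. by rewrite /qform mulmxN dotvNl dotvNr opprK. Qed.

Lemma qform_mxD {R : realType} {d} (M N : 'M[R]_d) x :
  qform (M + N) x = qform M x + qform N x.
Proof. by rewrite /qform mulmxDl dotvDr. Qed.

Lemma qform_mxN {R : realType} {d} (M : 'M[R]_d) x : qform (- M) x = - qform M x.
Proof. by rewrite /qform mulNmx dotvNr. Qed.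

Lemma qform_mxZ {R : realType} {d} a (M : 'M[R]_d) x :
  qform (a *: M) x = a * qform M x.
Proof. by rewrite /qform -scalemxAl dotvZr. Qed.

Lemma qformD {R : realType} {d} (M : 'M[R]_d) x y : symmx M ->
  qform M (x + y) = qform M x + qform M y + 2 * dotv x (M *m y).
Proof.
by move=> sM; rewrite /qform !dotvlin (dotv_sym _ y x sM); ring.
Qed.

Lemma qformZ {R : realType} {d} a (M : 'M[R]_d) x :
  qform M (a *: x) = a ^+ 2 * qform M x.
Proof. by rewrite /qform -scalemxAr dotvZl dotvZr; ring. Qed.

Lemma entry_qform {R : realType} {d} (M : 'M[R]_d) i j : symmx M ->
  M i j = (qform M (ebasis i + ebasis j) - qform M (ebasis i)
           - qform M (ebasis j)) / 2.
Proof.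
move=> sM; rewrite qformD // dotv_ebasis /ebasis -colE mxE; by field.
Qed.

Lemma symmxD {R : realType} {d} (M N : 'M[R]_d) :
  symmx M -> symmx N -> symmx (M + N).
Proof. by move=> sM sN; rewrite /symmx linearD /= sM sN. Qed.

Lemma symmxN {R : realType} {d} (M : 'M[R]_d) : symmx M -> symmx (- M).
Proof. by move=> sM; rewrite /symmx linearN /= sM. Qed.

Lemma symmxZ {R : realType} {d} a (M : 'M[R]_d) : symmx M -> symmx (a *: M).
Proof. by move=> sM; rewrite /symmx linearZ /= sM. Qed.

Lemma symmx_inv {R : realType} {d} (M : 'M[R]_d) : symmx M -> symmx (invmx M).
Proof. by move=> sM; rewrite /symmx trmx_inv sM. Qed.

Lemma posdef_ge0 {R : realType} {d} (M : 'M[R]_d) v :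
  posdefmx M -> 0 <= qform M v.
Proof.
move=> [_ pM]; have [->|v0] := eqVneq v 0; first by rewrite qform0.
exact/ltW/pM.
Qed.

(** If [M v] were nonzero, a small move from [v] in the direction [- M v] would make the form
    negative, its first-order change being [- 2 tau |M v|^2]. *)
Lemma psd_ker {R : realType} {d} (M : 'M[R]_d) v : symmx M ->
  (forall u, 0 <= qform M u) -> qform M v = 0 -> M *m v = 0.
Proof.
move=> sM pM v0; apply: dotv_eq0.
set n := dotv _ _; set q := qform M (M *m v).
have q0 : 0 <= q by exact: pM.
have n0 : 0 <= n by exact: dotv_ge0.
have H tau : 0 <= - 2 * tau * n + tau ^+ 2 * q.
  have := pM (v + (- tau) *: (M *m v)).
  rewrite qformD // v0 qformZ -/q -scalemxAr dotvZr (dotv_sym M v) // -/n.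
  by lra.
apply/eqP; rewrite eq_le n0 andbT leNgt; apply/negP => n1.
(* The step [tau = n / (q + 1)] makes the quadratic in [tau] negative; the added 1 covers
   [q = 0]. *)
have q1 : 0 < q + 1 by lra.
have := H (n / (q + 1)).
have -> : - 2 * (n / (q + 1)) * n + (n / (q + 1)) ^+ 2 * q =
  - (n ^+ 2 * (q + 2) / (q + 1) ^+ 2).
  by field; lra.
rewrite oppr_ge0 leNgt => /negP; apply.
by rewrite divr_gt0 ?mulr_gt0 ?exprn_gt0 //; lra.
Qed.

Lemma posdef_unit {R : realType} {d} (M : 'M[R]_d) : posdefmx M -> M \in unitmx.
Proof.
move=> [sM pM]; rewrite -unitmx_tr -row_free_unit -kermx_eq0.
apply/eqP/row_matrixP => i; rewrite row0.
set r := row i _.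
have rM : r *m M^T = 0 by rewrite /r -row_mul mulmx_ker row0.
have Mr : M *m r^T = 0 by rewrite -[LHS]trmxK trmx_mul trmxK rM trmx0.
apply: trmx_inj; rewrite trmx0; apply/eqP; apply/negPn/negP => /pM.
by rewrite /qform Mr dotv0r ltxx.
Qed.

Lemma qform_invmx {R : realType} {d} (M : 'M[R]_d) u : M \in unitmx ->
  qform M (invmx M *m u) = qform (invmx M) u.
Proof. by move=> uM; rewrite /qform mulKVmx // dotvC. Qed.

Lemma posdef_inv {R : realType} {d} (M : 'M[R]_d) :
  posdefmx M -> posdefmx (invmx M).
Proof.
move=> pM; have uM := posdef_unit _ pM; have sM := pM.1.
split; first exact: symmx_inv.
move=> v v0; have v'0 : invmx M *m v != 0.
  by apply: contra v0 => /eqP e; rewrite -(mulKVmx uM v) e mulmx0.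
by have := pM.2 _ v'0; rewrite /qform mulKVmx // dotvC.
Qed.

Lemma posdefD {R : realType} {d} (M N : 'M[R]_d) :
  posdefmx M -> posdefmx N -> posdefmx (M + N).
Proof.
move=> [sM pM] [sN pN]; split; first exact: symmxD.
by move=> v v0; rewrite qform_mxD addr_gt0 ?pM ?pN.
Qed.

Lemma posdefZ {R : realType} {d} a (M : 'M[R]_d) :
  0 < a -> posdefmx M -> posdefmx (a *: M).
Proof.
move=> a0 [sM pM]; split; first exact: symmxZ.
by move=> v v0; rewrite qform_mxZ mulr_gt0 ?pM.
Qed.

(** Fenchel-Young inequality, from expanding [qform M (v - M^-1 u) >= 0]. Equality holds at
    [v = M^-1 u], so the inverse form is a supremum over [v]; this replaces explicit inverses in the
    comparisons below. *)
Lemma inv_qform_ge {R : realType} {d} (M : 'M[R]_d) u v : posdefmx M ->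
  2 * dotv u v - qform M v <= qform (invmx M) u.
Proof.
move=> pM; have := posdef_ge0 M (v - invmx M *m u) pM.
rewrite qformD; last exact: pM.1.
rewrite qformN mulmxN dotvNr.
rewrite mulKVmx ?posdef_unit // {2}/qform mulKVmx ?posdef_unit //.
rewrite (dotvC (invmx M *m u)) (dotvC v) -/(qform _ u).
by move: (qform M v) (dotv u v) (qform (invmx M) u) => a b c; lra.
Qed.

(** The supremum for [N] is tested at [M^-1 u], the maximiser for [M]. *)
Lemma inv_qform_antimono {R : realType} {d} (M N : 'M[R]_d) u :
  posdefmx M -> posdefmx N -> (forall v, qform N v <= qform M v) ->
  qform (invmx M) u <= qform (invmx N) u.
Proof.
move=> pM pN NM; have := inv_qform_ge N u (invmx M *m u) pN.
apply: le_trans; have := NM (invmx M *m u).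
rewrite qform_invmx ?posdef_unit // -/(qform (invmx M) u); lra.
Qed.

Lemma dotv_CS_inv {R : realType} {d} (M : 'M[R]_d) u v : posdefmx M ->
  dotv u v ^+ 2 <= qform (invmx M) u * qform M v.
Proof.
move=> pM; have [->|v0] := eqVneq v 0.
  by rewrite dotv0r qform0 mulr0 expr0n.
have v1 := pM.2 _ v0.
(* Among the multiples of [v], this one maximises the left side of the Fenchel-Young bound. *)
have := inv_qform_ge M u ((dotv u v / qform M v) *: v) pM.
rewrite qformZ dotvZr -ler_pdivrMr //; apply: le_trans.
rewrite le_eqVlt; apply/orP; left; apply/eqP; field; lra.
Qed.

(* Coercivity: [v_i^2 <= (M^-1)_ii (v^T M v)] by Cauchy-Schwarz, hence the constant is the trace of the inverse. *)
Lemma dotv_le_qform {R : realType} {d} (M : 'M[R]_d) v : posdefmx M ->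
  dotv v v <= \tr (invmx M) * qform M v.
Proof.
move=> pM; rewrite /mxtrace mulr_suml; apply: ler_sum => i _.
have := dotv_CS_inv M (ebasis i) v pM.
by rewrite dotv_ebasis /qform dotv_ebasis /ebasis -colE mxE.
Qed.

(** * Gaussian integrals *)

Lemma measurable_expquad {R : realType} (w a b : R) :
  measurable_fun [set: R] (fun s : R => w * expR (- (a * s ^+ 2) / 2 + b * s)).
Proof.
apply: measurable_funM => //.
apply: measurableT_comp => //; apply: measurable_funD.
  apply: measurable_funM => //; apply: measurableT_comp => //.
  by apply: measurable_funM => //; apply: measurable_funX.
exact: measurable_funM.
Qed.

(** Completing the square gives a multiple of the normal density with mean [b / a] and variance
    [1 / a], whose integral is 1. *)
Lemma integral_expquad {R : realType} (w a b : R) : 0 <= w -> 0 < a ->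
  (\int[@lebesgue_measure R]_(s in setT)
     (w * expR (- (a * s ^+ 2) / 2 + b * s))%:E)%E =
  (w * (Num.sqrt (2 * pi / a) * expR (b ^+ 2 / a / 2)))%:E.
Proof.
move=> w0 a0; set sg := (Num.sqrt a)^-1.
have sg0 : sg != 0 by rewrite invr_eq0 gt_eqF // sqrtr_gt0.
have sg2 : sg ^+ 2 = a^-1 by rewrite exprVn sqr_sqrtr // ltW.
have pi0 := pi_gt0 R.
set W := w * _.
transitivity (\int[@lebesgue_measure R]_(s in setT)
   (W%:E * (normal_pdf (b / a) sg s)%:E))%E; last first.
  by rewrite integralZl ?integral_normal_pdf ?mule1 //; exact: integrable_normal_pdf.
apply: eq_integral => s _; rewrite -EFinM; congr EFin.
rewrite normal_pdfE // /normal_peak /normal_fun sg2 /W.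
have -> : a^-1 * pi *+ 2 = 2 * pi / a by ring.
set r := Num.sqrt _.
have r0 : r != 0 by rewrite gt_eqF // sqrtr_gt0 divr_gt0 // mulr_gt0.
rewrite -[RHS]mulrA; congr (_ * _); rewrite mulrACA divff // mul1r -expRD.
by congr expR; field; lra.
Qed.

Lemma integral_sum_expquad {R : realType} (K : nat) (w a b : 'I_K -> R) :
  (forall k, 0 <= w k) -> (forall k, 0 < a k) ->
  (\int[@lebesgue_measure R]_(s in setT)
     (\sum_(k < K) w k * expR (- (a k * s ^+ 2) / 2 + b k * s))%:E)%E =
  (\sum_(k < K) w k * (Num.sqrt (2 * pi / a k) * expR (b k ^+ 2 / a k / 2)))%:E.
Proof.
move=> w0 a0; under eq_integral do rewrite -sumEFin.
rewrite ge0_integral_sum //; last 2 first.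
- by move=> k; apply/measurable_EFinP; exact: measurable_expquad.
- by move=> k s _; rewrite lee_fin mulr_ge0 ?expR_ge0.
by rewrite -sumEFin; apply: eq_bigr => k _; rewrite integral_expquad.
Qed.

(** If [a <= 0], the integrand is at least [w] on the half-line where [b s >= 0], which has infinite
    measure. *)
Lemma expquad_finite {R : realType} (w a b : R) : 0 < w ->
  (\int[@lebesgue_measure R]_(s in setT)
     (w * expR (- (a * s ^+ 2) / 2 + b * s))%:E < +oo)%E -> 0 < a.
Proof.
move=> w0; apply: contraLR; rewrite -!leNgt => a0.
have [D [mD DE bD]] : exists D : set R, [/\ measurable D,
    lebesgue_measure D = +oo%E & forall s, D s -> 0 <= b * s].
  have [b0|/ltW b0] := leP 0 b.
    exists `[0, +oo[%classic; split => //; first by rewrite lebesgue_measure_itv /= ltry.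
    by move=> s; rewrite /= in_itv /= andbT => s0; rewrite mulr_ge0.
  exists `]-oo, 0]%classic; split => //; first by rewrite lebesgue_measure_itv /= ltNyr.
  by move=> s; rewrite /= in_itv /= => s0; rewrite mulr_le0.
have <- : (\int[@lebesgue_measure R]_(s in D) cst w%:E s)%E = +oo%E.
  by rewrite integral_cst // [X in (_ * X)%E]DE gt0_muley // lte_fin.
have f0 s : (0 <= (w * expR (- (a * s ^+ 2) / 2 + b * s))%:E)%E.
  by rewrite lee_fin mulr_ge0 ?expR_ge0 // ltW.
apply: (@le_trans _ _ (\int[@lebesgue_measure R]_(s in D)
     (w * expR (- (a * s ^+ 2) / 2 + b * s))%:E)%E).
  apply: ge0_le_integral => //.
  - by move=> s _; rewrite lee_fin ltW.
  - by apply/measurable_EFinP; apply: measurable_funS (measurable_expquad w a b).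
  move=> s /bD bs; rewrite lee_fin ler_peMr ?(ltW w0) // -[leLHS]expR0 ler_expR.
  have := sqr_ge0 s => s2.
  have : 0 <= - a * s ^+ 2 by rewrite mulr_ge0 // oppr_ge0.
  by rewrite mulNr; lra.
by apply: ge0_subset_integral => //; apply/measurable_EFinP; exact: measurable_expquad.
Qed.

(** * Block elimination of the first coordinate and Gaussian integrals in several variables *)

Lemma dotv_col_mx {R : realType} {d} (s r : R) (u v : 'cV[R]_d) :
  dotv (col_mx (const_mx s : 'cV_1) u) (col_mx (const_mx r : 'cV_1) v) =
  s * r + dotv u v.
Proof.
rewrite !dotvE tr_col_mx mul_row_col mxE; congr (_ + _).
by rewrite mxE big_ord1 !mxE.
Qed.

Lemma cV_split {R : realType} {d} (v : 'cV[R]_(1 + d)) :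
  v = col_mx (const_mx (v 0 0) : 'cV_1) (dsubmx v).
Proof.
rewrite -[LHS]vsubmxK; congr col_mx; apply/matrixP => i j.
by rewrite !ord1 !mxE; congr (v _ _); apply: val_inj.
Qed.

Lemma mul_block_col_mx {R : realType} {d} (A : 'M[R]_(1 + d)) s (w : 'cV_d) :
  symmx A -> A *m col_mx (const_mx s : 'cV_1) w =
  col_mx (const_mx (A 0 0 * s + dotv (dlsubmx A) w) : 'cV_1)
         (s *: dlsubmx A + drsubmx A *m w).
Proof.
move=> sA; rewrite -{1}(submxK A) mul_block_col; congr col_mx.
  apply/matrixP => i j; rewrite !ord1 !mxE big_ord1 !mxE.
  congr (A _ _ * _ + _); try exact: val_inj.
  by apply: eq_bigr => k _; rewrite !mxE -[in LHS]sA mxE.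
congr (_ + _); apply/matrixP => i j; rewrite !ord1 !mxE big_ord1 !mxE mulrC.
by [].
Qed.

Lemma qform_col_mx {R : realType} {d} (A : 'M[R]_(1 + d)) s (w : 'cV_d) :
  symmx A -> qform A (col_mx (const_mx s : 'cV_1) w) =
  A 0 0 * s ^+ 2 + 2 * s * dotv (dlsubmx A) w + qform (drsubmx A) w.
Proof.
move=> sA; rewrite /qform mul_block_col_mx // dotv_col_mx !dotvlin.
by rewrite (dotvC w (dlsubmx A)); ring.
Qed.

(** The scalar Schur complement of the lower block: the coefficient of the first coordinate's square
    once the other coordinates are minimised, or integrated, out. *)
Definition schur {R : realType} {d} (A : 'M[R]_(1 + d)) : R :=
  A 0 0 - qform (invmx (drsubmx A)) (dlsubmx A).

Lemma symmx_drsub {R : realType} {d} (A : 'M[R]_(1 + d)) :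
  symmx A -> symmx (drsubmx A).
Proof. by move=> sA; rewrite /symmx trmx_drsub sA. Qed.

Lemma posdef_drsub {R : realType} {d} (A : 'M[R]_(1 + d)) :
  posdefmx A -> posdefmx (drsubmx A).
Proof.
move=> [sA pA]; split; first exact: symmx_drsub.
move=> v v0; have := pA (col_mx (const_mx 0 : 'cV_1) v).
rewrite qform_col_mx //; rewrite expr0n !mulr0 mul0r !add0r; apply.
by apply: contra v0 => /eqP /(congr1 dsubmx); rewrite col_mxKd linear0 => ->.
Qed.

Lemma qform_schur {R : realType} {d} (A : 'M[R]_(1 + d)) s (w : 'cV_d) :
  symmx A -> drsubmx A \in unitmx ->
  qform A (col_mx (const_mx s : 'cV_1) w) =
  schur A * s ^+ 2 + qform (drsubmx A) (w + s *: (invmx (drsubmx A) *m dlsubmx A)).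
Proof.
move=> sA uD; rewrite qform_col_mx // qformD; last exact: symmx_drsub.
rewrite qformZ qform_invmx // -scalemxAr mulKVmx // dotvZr /schur.
by rewrite (dotvC w); ring.
Qed.

Lemma schur_gt0 {R : realType} {d} (A : 'M[R]_(1 + d)) :
  posdefmx A -> 0 < schur A.
Proof.
move=> pA; have uD := posdef_unit _ (posdef_drsub _ pA).
(* Among vectors with first coordinate 1 this one minimises the form: the second square vanishes and
   only [schur A] is left. *)
have := pA.2 (col_mx (const_mx 1 : 'cV_1) (- (invmx (drsubmx A) *m dlsubmx A))).
rewrite qform_schur //; last exact: pA.1.
rewrite scale1r addNr qform0 expr1n mulr1 addr0; apply.
apply/eqP => /matrixP/(_ (lshift d 0) 0).
by rewrite col_mxEu !mxE => /eqP; rewrite oner_eq0.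
Qed.

Lemma schur_posdef {R : realType} {d} (A : 'M[R]_(1 + d)) :
  symmx A -> posdefmx (drsubmx A) -> 0 < schur A -> posdefmx A.
Proof.
move=> sA pD c0; split => // v; rewrite (cV_split v) => v0.
rewrite qform_schur ?posdef_unit //.
have [s0|s0] := eqVneq (v 0 0) 0; last first.
  by rewrite ltr_wpDr ?posdef_ge0 // mulr_gt0 // exprn_even_gt0.
rewrite s0 scale0r addr0 expr0n mulr0 add0r; apply: pD.2.
apply: contra v0 => /eqP ->; rewrite s0; apply/eqP/matrixP => i j.
by rewrite !mxE; case: splitP => k _; rewrite mxE.
Qed.

Lemma det_schur {R : realType} {d} (A : 'M[R]_(1 + d)) :
  symmx A -> drsubmx A \in unitmx -> \det A = schur A * \det (drsubmx A).
Proof.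
(* Column elimination: [A *m X] is block upper triangular with diagonal blocks [schur A] and
   [drsubmx A], and [X] has determinant 1. *)
move=> sA uD; set X := block_mx (1%:M : 'M[R]_1) 0 (- (invmx (drsubmx A) *m dlsubmx A)) 1%:M.
have dX : \det X = 1 by rewrite det_lblock !det1 mulr1.
rewrite -[LHS]mulr1 -dX -det_mulmx -{1}(submxK A) mulmx_block.
rewrite !mulmx1 !mulmx0 !add0r !mulmxN mulKVmx // subrr det_ublock.
congr (_ * _); rewrite det_mx11 /schur /qform dotvE trmx_dlsub sA.
have -> (Y Z : 'M[R]_1) : (Y - Z) 0 0 = Y 0 0 - Z 0 0 by rewrite !mxE.
congr (_ - _); by rewrite !mxE; congr (A _ _); apply: val_inj.
Qed.

Lemma posdef_det {R : realType} {d} (A : 'M[R]_d) : posdefmx A -> 0 < \det A.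
Proof.
elim: d A => [|d IH] A pA; first by rewrite det_mx00.
have pD := posdef_drsub (A : 'M[R]_(1 + d)) pA.
rewrite (det_schur (A : 'M[R]_(1 + d))) ?posdef_unit //; last exact: pA.1.
by rewrite mulr_gt0 ?IH // schur_gt0.
Qed.

(** The two terms are the exponents produced by integrating first over the lower coordinates and
    then over the first one. The proof solves [A z = (h, g)] by elimination and evaluates
    [dotv z (A z)]. *)
Lemma inv_qform_schur {R : realType} {d} (A : 'M[R]_(1 + d)) h (g : 'cV_d) :
  posdefmx A ->
  qform (invmx A) (col_mx (const_mx h : 'cV_1) g) =
  qform (invmx (drsubmx A)) g
  + (h - dotv (dlsubmx A) (invmx (drsubmx A) *m g)) ^+ 2 / schur A.
Proof.
move=> pA; have pD := posdef_drsub A pA; have c0 := schur_gt0 A pA.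
have sDi := symmx_inv _ pD.1; have sA := pA.1.
set D := drsubmx A; set b := dlsubmx A; set c := schur A.
set s := (h - dotv b (invmx D *m g)) / c.
set z := col_mx (const_mx s : 'cV_1) (invmx D *m (g - s *: b)).
have -> : col_mx (const_mx h : 'cV_1) g = A *m z.
  rewrite /z mul_block_col_mx // -/D mulKVmx ?posdef_unit //.
  rewrite -/b [s *: b + _]addrC subrK; congr (col_mx (const_mx _) _).
  rewrite !dotvlin -scalemxAr dotvZr -/b -/D -/(qform _ b).
  rewrite -[A 0 0](subrK (qform (invmx D) b)) -/(schur A) -/c /s.
  by field; rewrite gt_eqF.
rewrite /qform mulKmx ?posdef_unit // dotvC.
rewrite /z mul_block_col_mx // -/b -/D mulKVmx ?posdef_unit //.
rewrite dotv_col_mx [s *: b + _]addrC subrK.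
rewrite !dotvlin -!scalemxAr !dotvlin.
rewrite -[A 0 0](subrK (qform (invmx D) b)) -/(schur A) -/c.
rewrite (dotvC (invmx D *m b)) (dotv_sym _ g b) // (dotvC _ g) -/(qform _ g) -/(qform _ b) /s.
by field; rewrite gt_eqF.
Qed.

(** The value of the integral of [exp(- x^T A x / 2 + b . x)] for positive definite [A]. *)
Definition gauss_int {R : realType} {d} (A : 'M[R]_d) (b : 'cV[R]_d) : R :=
  Num.sqrt ((2 * pi) ^+ d / \det A) * expR (qform (invmx A) b / 2).

Lemma gauss_int_gt0 {R : realType} {d} (A : 'M[R]_d) b :
  posdefmx A -> 0 < gauss_int A b.
Proof.
move=> pA; rewrite mulr_gt0 ?expR_gt0 // sqrtr_gt0.
by rewrite divr_gt0 ?posdef_det // exprn_gt0 // mulr_gt0 ?pi_gt0.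
Qed.

Lemma expquad_col_mx {R : realType} {d} (A : 'M[R]_(1 + d)) (b : 'cV[R]_(1 + d)) s v :
  symmx A ->
  expR (- qform A (col_mx (const_mx s : 'cV_1) v) / 2
        + dotv b (col_mx (const_mx s : 'cV_1) v)) =
  expR (- (A 0 0 * s ^+ 2) / 2 + b 0 0 * s) *
  expR (- qform (drsubmx A) v / 2 + dotv (dsubmx b - s *: dlsubmx A) v).
Proof.
move=> sA; rewrite -expRD qform_col_mx // {1}(cV_split b) dotv_col_mx !dotvlin.
by congr expR; field.
Qed.

(** Only the lower block has to be positive definite, so the identity serves both to evaluate the
    integral and to test its finiteness, where the sign of [schur A] is the question. *)
Lemma gauss_int_col_mx {R : realType} {d} (A : 'M[R]_(1 + d)) (b : 'cV[R]_(1 + d)) s :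
  posdefmx (drsubmx A) ->
  expR (- (A 0 0 * s ^+ 2) / 2 + b 0 0 * s) *
  gauss_int (drsubmx A) (dsubmx b - s *: dlsubmx A) =
  gauss_int (drsubmx A) (dsubmx b) *
  expR (- (schur A * s ^+ 2) / 2
        + (b 0 0 - dotv (dlsubmx A) (invmx (drsubmx A) *m dsubmx b)) * s).
Proof.
move=> pD; have sDi := symmx_inv _ pD.1.
rewrite /gauss_int mulrCA -!mulrA -!expRD; congr (_ * expR _).
rewrite -[- (s *: _)]scaleNr qformD // qformZ -scalemxAr dotvZr (dotv_sym _ (dsubmx b)) //.
by rewrite /schur; field.
Qed.

(** The finite sum is part of the statement because [intRd] is an iterated integral: the induction
    on the dimension then exchanges sum and integral only on the line. *)
Lemma intRd_sum_expquad {R : realType} {d} (K : nat) (w : 'I_K -> R)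
  (A : 'I_K -> 'M[R]_d) (b : 'I_K -> 'cV[R]_d) :
  (forall k, 0 <= w k) -> (forall k, posdefmx (A k)) ->
  intRd (fun x => (\sum_(k < K) w k * expR (- qform (A k) x / 2 + dotv (b k) x))%:E)
  = (\sum_(k < K) w k * gauss_int (A k) (b k))%:E.
Proof.
elim: d w A b => [|d IH] w A b w0 pA.
  rewrite /=; congr EFin; apply: eq_bigr => k _; rewrite /gauss_int.
  rewrite !qform0 dotv0r det_mx00 expr0 divr1 sqrtr1 mul1r; congr (_ * expR _).
  by rewrite /qform /dotv big_ord0 oppr0 addr0.
rewrite /=.
under eq_integral => s _.
  under eq_fun => v do under eq_bigr => k _ do
    rewrite (expquad_col_mx (A k) (b k) s v (pA k).1) mulrA.
  rewrite IH; last 2 first.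
  - by move=> k; rewrite mulr_ge0 ?expR_ge0.
  - by move=> k; exact: posdef_drsub.
  under eq_bigr => k _ do
    rewrite -mulrA (gauss_int_col_mx (A k) (b k) s (posdef_drsub _ (pA k))) mulrA.
  over.
rewrite integral_sum_expquad; last 2 first.
- by move=> k; rewrite mulr_ge0 // ltW // gauss_int_gt0 //; exact: posdef_drsub.
- by move=> k; exact: schur_gt0.
congr EFin; apply: eq_bigr => k _; rewrite -mulrA; congr (_ * _).
have pD := posdef_drsub _ (pA k).
rewrite /gauss_int [in RHS](det_schur (A k : 'M[R]_(1 + d))) ?posdef_unit //; last exact: (pA k).1.
rewrite [in RHS](cV_split (b k : 'cV[R]_(1 + d))) inv_qform_schur //.
rewrite mulrACA -expRD; congr (_ * expR _); last by rewrite mulrDl.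
rewrite -sqrtrM; last first.
  by rewrite divr_ge0 ?(ltW (posdef_det _ pD)) // exprn_ge0 // mulr_ge0 ?pi_ge0.
congr Num.sqrt; rewrite exprS.
have := posdef_det _ pD; have := schur_gt0 _ (pA k).
by move=> c0 d0; field; rewrite !gt_eqF.
Qed.

Lemma intRd_expquad {R : realType} {d} (w : R) (A : 'M[R]_d) (b : 'cV[R]_d) :
  0 <= w -> posdefmx A ->
  intRd (fun x => (w * expR (- qform A x / 2 + dotv b x))%:E)
  = (w * gauss_int A b)%:E.
Proof.
move=> w0 pA.
have := @intRd_sum_expquad R d 1 (fun=> w) (fun=> A) (fun=> b) (fun=> w0) (fun=> pA).
by under eq_fun do rewrite big_ord1; rewrite big_ord1.
Qed.

(** The outer integrand is itself a one-dimensional Gaussian exponential with leading coefficient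
    [schur A], so finiteness forces that coefficient to be positive, provided the lower block is
    positive definite. *)
Lemma intRd_finite_posdef {R : realType} {d} (w : R) (A : 'M[R]_d) (b : 'cV[R]_d) :
  0 < w -> symmx A ->
  (intRd (fun x => (w * expR (- qform A x / 2 + dotv b x))%:E) < +oo)%E ->
  posdefmx A.
Proof.
elim: d w A b => [|d IH] w A b w0 sA.
  by move=> _; split => // v; rewrite (flatmx0 v) eqxx.
rewrite /= => fin.
have Es s : (fun v : 'cV[R]_d => (w * expR (- qform A (col_mx (const_mx s : 'cV_1) v) / 2
        + dotv b (col_mx (const_mx s : 'cV_1) v)))%:E) =
   (fun v => ((w * expR (- (A 0 0 * s ^+ 2) / 2 + b 0 0 * s)) *
     expR (- qform (drsubmx (A : 'M[R]_(1 + d))) v / 2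
       + dotv (dsubmx (b : 'cV[R]_(1 + d)) - s *: dlsubmx (A : 'M[R]_(1 + d))) v))%:E).
  by apply/funext => v; rewrite (expquad_col_mx (A : 'M[R]_(1 + d))) ?mulrA.
have pD : posdefmx (drsubmx (A : 'M[R]_(1 + d))).
  (* Whether the inner integral is finite does not depend on [s]: by the induction hypothesis it
     would be infinite for every [s]. *)
  apply: contrapT => npD; move: fin; apply/negP; rewrite -leNgt.
  rewrite (_ : (fun s => _) = cst +oo%E); last first.
    apply/funext => s; rewrite Es /=; apply/eqP; rewrite -leye_eq leNgt.
    apply/negP => fin; apply: npD; apply: IH fin; last exact: symmx_drsub.
    by rewrite mulr_gt0 ?expR_gt0.
  have mT : lebesgue_measure [set: R] = +oo%E by rewrite -set_itvNyy lebesgue_measure_itv.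
  by rewrite integral_cst // [X in (_ * X)%E]mT mulyy.
apply: (schur_posdef (A : 'M[R]_(1 + d))) => //.
have W0 := mulr_gt0 w0 (gauss_int_gt0 _ (dsubmx (b : 'cV[R]_(1 + d))) pD).
rewrite (_ : (fun s => _) = fun s : R =>
  (w * gauss_int (drsubmx (A : 'M[R]_(1 + d))) (dsubmx (b : 'cV[R]_(1 + d))) *
   expR (- (schur (A : 'M[R]_(1 + d)) * s ^+ 2) / 2
     + (b 0 0 - dotv (dlsubmx (A : 'M[R]_(1 + d)))
         (invmx (drsubmx (A : 'M[R]_(1 + d))) *m dsubmx (b : 'cV[R]_(1 + d)))) * s))%:E)
  in fin; first exact: expquad_finite W0 fin.
apply/funext => s; rewrite Es intRd_expquad ?mulr_ge0 ?expR_ge0 ?(ltW w0) //.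
by rewrite -mulrA (gauss_int_col_mx (A : 'M[R]_(1 + d))) // mulrA.
Qed.

(** * Entrywise limits of matrices *)

(** An arbitrary filter is allowed, to cover one-sided limits, limits within an interval and
    difference quotients alike. *)
Definition mxcvg {R : realType} {T : Type} {m n} (F : set_system T)
  (X : T -> 'M[R]_(m, n)) (X0 : 'M[R]_(m, n)) : Prop :=
  forall i j, X s i j @[s --> F] --> X0 i j.

Lemma cvgr_sum {R : realType} {T I : Type} (F : set_system T) {FF : Filter F}
  (r : seq I) (f : I -> T -> R) (l : I -> R) :
  (forall i, f i s @[s --> F] --> l i) ->
  \sum_(i <- r) f i s @[s --> F] --> \sum_(i <- r) l i.
Proof. by move=> fl; apply: cvg_big => //; exact: add_continuous. Qed.

Lemma cvgr_prod {R : realType} {T I : Type} (F : set_system T) {FF : Filter F}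
  (r : seq I) (f : I -> T -> R) (l : I -> R) :
  (forall i, f i s @[s --> F] --> l i) ->
  \prod_(i <- r) f i s @[s --> F] --> \prod_(i <- r) l i.
Proof. by move=> fl; apply: cvg_big => //; exact: mul_continuous. Qed.

Lemma mxcvg_cst {R : realType} {T : Type} {m n} (F : set_system T)
  {FF : Filter F} (X : 'M[R]_(m, n)) : mxcvg F (fun=> X) X.
Proof. by move=> i j; exact: cvg_cst. Qed.

Lemma mxcvgB {R : realType} {T : Type} {m n} (F : set_system T)
  {FF : Filter F} (X Y : T -> 'M[R]_(m, n)) X0 Y0 :
  mxcvg F X X0 -> mxcvg F Y Y0 -> mxcvg F (fun s => X s - Y s) (X0 - Y0).
Proof.
move=> hX hY i j; under eq_cvg do rewrite !mxE; rewrite !mxE.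
exact: cvgB (hX i j) (hY i j).
Qed.

Lemma mxcvgM {R : realType} {T : Type} {m n p} (F : set_system T)
  {FF : Filter F} (X : T -> 'M[R]_(m, n)) (Y : T -> 'M[R]_(n, p)) X0 Y0 :
  mxcvg F X X0 -> mxcvg F Y Y0 -> mxcvg F (fun s => X s *m Y s) (X0 *m Y0).
Proof.
move=> hX hY i j; under eq_cvg do rewrite mxE; rewrite mxE.
by apply: cvgr_sum => k; exact: cvgM (hX i k) (hY k j).
Qed.

Lemma cvg_dotv {R : realType} {T : Type} {d} (F : set_system T)
  {FF : Filter F} (X Y : T -> 'cV[R]_d) X0 Y0 :
  mxcvg F X X0 -> mxcvg F Y Y0 -> dotv (X s) (Y s) @[s --> F] --> dotv X0 Y0.
Proof. by move=> hX hY; apply: cvgr_sum => k; exact: cvgM (hX k 0) (hY k 0). Qed.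

Lemma cvg_det {R : realType} {T : Type} {n} (F : set_system T)
  {FF : Filter F} (X : T -> 'M[R]_n) X0 :
  mxcvg F X X0 -> \det (X s) @[s --> F] --> \det X0.
Proof.
move=> hX; apply: cvgr_sum => p; apply: cvgM; first exact: cvg_cst.
by apply: cvgr_prod => i; exact: hX.
Qed.

Lemma mxcvg_inv {R : realType} {T : Type} {n} (F : set_system T)
  {FF : Filter F} (X : T -> 'M[R]_n) X0 :
  mxcvg F X X0 -> X0 \in unitmx -> (\forall s \near F, X s \in unitmx) ->
  mxcvg F (fun s => invmx (X s)) (invmx X0).
Proof.
move=> hX uX0 uX i j.
(* [invmx] returns its argument on singular matrices, so the cofactor formula is available only
   where the matrix is a unit. *)
have E (Y : 'M[R]_n) : Y \in unitmx -> invmx Y i j = (\det Y)^-1 * cofactor Y j i.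
  by move=> uY; rewrite /invmx uY !mxE.
apply: (@cvg_trans _ ((\det (X s))^-1 * cofactor (X s) j i @[s --> F])).
  by apply: near_eq_cvg; near=> s; apply/esym/E; near: s; exact: uX.
rewrite E //; apply: cvgM.
  apply: cvgV; first by move: uX0; rewrite unitmxE unitfE.
  exact: cvg_det.
apply: cvgM; first exact: cvg_cst.
apply: cvg_det => k l; under eq_cvg do rewrite !mxE; rewrite !mxE.
exact: hX.
Unshelve. all: by end_near. Qed.

(** The limit [l] is not known beforehand to be a quadratic form, so the limit matrix is built from
    it by polarisation. This is what happens for difference quotients. *)
Lemma mxcvg_polar {R : realType} {T : Type} {d} (F : set_system T)
  {FF : Filter F} (X : T -> 'M[R]_d) (l : 'cV[R]_d -> R) :
  (\forall s \near F, symmx (X s)) ->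
  (forall v, qform (X s) v @[s --> F] --> l v) ->
  mxcvg F X (\matrix_(i, j) ((l (ebasis i + ebasis j) - l (ebasis i) - l (ebasis j)) / 2)).
Proof.
move=> sX hX i j; rewrite mxE.
apply: (@cvg_trans _ ((qform (X s) (ebasis i + ebasis j) - qform (X s) (ebasis i)
  - qform (X s) (ebasis j)) / 2 @[s --> F])).
  by apply: near_eq_cvg; near=> s; rewrite -entry_qform //; near: s.
by apply: cvgM; [apply: cvgB; [apply: cvgB; exact: hX|exact: hX]|exact: cvg_cst].
Unshelve. all: by end_near. Qed.

Lemma mxcvg_qform {R : realType} {T : Type} {d} (F : set_system T)
  {FF : Filter F} (X : T -> 'M[R]_d) X0 :
  (\forall s \near F, symmx (X s)) -> symmx X0 ->
  (forall v, qform (X s) v @[s --> F] --> qform X0 v) -> mxcvg F X X0.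
Proof.
move=> sX sX0 hX; rewrite [X0](_ : _ = \matrix_(i, j) ((qform X0 (ebasis i + ebasis j)
  - qform X0 (ebasis i) - qform X0 (ebasis j)) / 2)); first exact: mxcvg_polar.
by apply/matrixP => i j; rewrite mxE -entry_qform.
Qed.

Lemma qform_le_sum {R : realType} {d} (D : 'M[R]_d) v :
  `|qform D v| <= (\sum_i \sum_j `|D i j|) * dotv v v.
Proof.
have vi (i : 'I_d) : v i 0 ^+ 2 <= dotv v v.
  rewrite /dotv (bigD1 i) //= -expr2 lerDl.
  by apply: sumr_ge0 => j _; rewrite -expr2 sqr_ge0.
rewrite /qform {1}/dotv mulr_suml.
apply: le_trans (ler_norm_sum _ _ _) _; apply: ler_sum => i _.
rewrite mxE mulr_sumr mulr_suml.
apply: le_trans (ler_norm_sum _ _ _) _; apply: ler_sum => j _.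
rewrite mulrCA normrM ler_wpM2l //.
have := vi i; have := vi j; rewrite normrM -(real_normK (num_real (v i 0))).
rewrite -(real_normK (num_real (v j 0))).
move: `|_| `|_| (dotv v v) => a b c ha hb.
by have := sqr_ge0 (a - b); rewrite sqrrB; lra.
Qed.

(** Coercivity gives [|v|^2 <= c * qform X0 v], whereas the perturbation changes the form by at most
    the sum of the entry differences times [|v|^2]; positivity survives once [c] times that sum is
    below 1. *)
Lemma posdef_near {R : realType} {T : Type} {d} (F : set_system T)
  {FF : Filter F} (X : T -> 'M[R]_d) X0 :
  (\forall s \near F, symmx (X s)) -> mxcvg F X X0 -> posdefmx X0 ->
  \forall s \near F, posdefmx (X s).
Proof.
move=> sX hX pX0; set c := \tr (invmx X0).
have hd0 : \sum_i \sum_j `|(X s - X0) i j| @[s --> F] --> \sum_(i < d) \sum_(j < d) (0 : R).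
  apply: cvgr_sum => i; apply: cvgr_sum => j.
  under eq_cvg do rewrite !mxE.
  have : `|X s i j - X0 i j| @[s --> F] --> `|X0 i j - X0 i j|.
    by apply: cvg_norm; apply: cvgB; [exact: hX|exact: cvg_cst].
  by rewrite subrr normr0.
have hd : c * (\sum_i \sum_j `|(X s - X0) i j|) @[s --> F] --> c * 0.
  apply: cvgM; first exact: cvg_cst.
  have z : \sum_(i < d) \sum_(j < d) (0 : R) = 0 by rewrite big1 // => i _; rewrite big1.
  by rewrite z in hd0.
rewrite mulr0 in hd.
near=> s; split; first by near: s.
have : c * (\sum_i \sum_j `|(X s - X0) i j|) < 1.
  by near: s; exact: (cvgr_lt 0 hd 1 ltr01).
set e := c * _ => e1.
move=> v v0; have v1 := dotv_gt0 _ v0.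
have vc := dotv_le_qform X0 v pX0.
(* [c > 0] rests on the existence of a nonzero [v]: in dimension 0 the trace is 0. *)
have c0 : 0 < c by rewrite -(pmulr_lgt0 _ (pX0.2 v v0)); exact: lt_le_trans vc.
rewrite -(pmulr_rgt0 _ c0) -[X s](subrK X0) addrC qform_mxD mulrDr.
have := qform_le_sum (X s - X0) v; set q := qform _ _ => hq.
have : `|c * q| <= e * dotv v v.
  by rewrite normrM (ger0_norm (ltW c0)) -mulrA ler_pM2l.
rewrite ler_norml => /andP[+ _].
have : e * dotv v v < dotv v v by rewrite gtr_pMl.
by move: vc; rewrite -/c; lra.
Unshelve. all: by end_near. Qed.

(** * Difference quotients and monotonicity on the line *)

Lemma is_derive1_cvg {R : realType} (f : R -> R) (t df : R) : is_derive t 1 f df ->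
  h^-1 * (f (h + t) - f t) @[h --> 0^'] --> df.
Proof.
move=> [dft <-]; rewrite /derive; move: dft; rewrite /derivable => /cvg_ex [l hl].
by rewrite (cvg_lim _ hl) //; under eq_cvg => h do rewrite -[h in h + t]mulr1.
Qed.

Lemma cvg_is_derive1 {R : realType} (f : R -> R) (t df : R) :
  h^-1 * (f (h + t) - f t) @[h --> 0^'] --> df -> is_derive t 1 f df.
Proof.
move=> hf.
have hf' : h^-1 *: ((f \o shift t) (h *: 1) - f t) @[h --> 0^'] --> df.
  by under eq_cvg => h do rewrite /= [h *: 1]mulr1.
by apply: DeriveDef; [apply/cvg_ex; exists df|exact: cvg_lim hf'].
Qed.

(** The Green equations say nothing at the grid times, whence the finite exceptional set. The
    induction splits the interval at each exceptional point inside it, and continuity glues the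
    pieces. *)
Lemma nondecreasing_off_finite {R : realType} (E : seq R) (f : R -> R) (a b : R) :
  a <= b -> {within `[a, b], continuous f} ->
  (forall t, a < t < b -> t \notin E ->
     exists2 df, 0 <= df & is_derive t 1 f df) ->
  f a <= f b.
Proof.
elim: E a b => [|e E IH] a b ab cf df.
  apply: (ger0_derive1_le_cc _ _ cf); rewrite ?in_itv /= ?lexx ?ab //.
  - by move=> t; rewrite in_itv /= => /df[]// d d0 [].
  - move=> t; rewrite in_itv /= => /df[]// d d0 hd.
    by rewrite derive1E (@derive_val _ _ _ _ _ _ _ hd).
have [/andP[ae eb]|/negP nab] := boolP (a < e < b).
  apply: (@le_trans _ _ (f e)); apply: IH.
  - exact: ltW.
  - by apply: continuous_subspaceW cf; apply: subset_itvl; rewrite bnd_simp ltW.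
  - move=> t /andP[at' te] tE; apply: df; first by rewrite at' (lt_trans te eb).
    by rewrite inE negb_or tE lt_eqF.
  - exact: ltW.
  - by apply: continuous_subspaceW cf; apply: subset_itvr; rewrite bnd_simp ltW.
  - move=> t /andP[at' te] tE; apply: df; first by rewrite te (lt_trans ae at').
    by rewrite inE negb_or tE gt_eqF.
apply: IH => // t tab tE; apply: df => //; rewrite inE negb_or tE andbT.
by apply/eqP => te; apply: nab; rewrite -te.
Qed.

Lemma is_derive1D {R : realType} (f g : R -> R) (t df dg : R) :
  is_derive t 1 f df -> is_derive t 1 g dg ->
  is_derive t 1 (fun s => f s + g s) (df + dg).
Proof. by move=> hf hg; apply: (@is_deriveD _ _ _ f g). Qed.

Lemma is_derive1N {R : realType} (f : R -> R) (t df : R) :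
  is_derive t 1 f df -> is_derive t 1 (fun s => - f s) (- df).
Proof. by move=> hf; apply: (@is_deriveN _ _ _ f). Qed.

(** * Positivity along the Riccati flow *)

Lemma within_continuous_cvg {R : realType} (S : set R) (f : R -> R) t :
  S t -> {within S, continuous f} -> f s @[s --> within S (nbhs t)] --> f t.
Proof. by move=> St cf; rewrite nbhs_subspace_in //; exact: cf. Qed.

Lemma near_within_itv {R : realType} (a b t : R) (P : set R) :
  (\forall s \near within `[a, b] (nbhs t), P s) ->
  exists2 e, 0 < e & forall s, a <= s <= b -> `|t - s| < e -> P s.
Proof.
move=> /nbhs_ballP[e /= e0 he]; exists e => // s sab ts; apply: he => //.
Qed.

(* At the first time where [A] fails to be positive definite, [A v = 0] for some [v != 0]; just before, [v^T A v > 0] decreases to [0], whereas its derivative tends to [v^T beta v > 0]. *)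
Lemma posdef_riccati {R : realType} {d n} (E : seq R) (A : R -> 'M[R]_d) (a b : R)
  (beta sigma : 'I_n -> 'M[R]_d) (kappa : 'I_n -> R) :
  a <= b -> (forall j, posdefmx (beta j)) ->
  (forall s, a <= s <= b -> symmx (A s)) ->
  (forall v, {within `[a, b], continuous (fun s => qform (A s) v)}) ->
  (forall s, a < s < b -> s \notin E -> exists j, forall v,
    is_derive s 1 (fun r => qform (A r) v)
      (qform (beta j) v - 2 * dotv (sigma j *m v) (A s *m v)
       - kappa j * dotv (A s *m v) (A s *m v))) ->
  posdefmx (A a) -> posdefmx (A b).
Proof.
move=> ab pbeta sA cA dA pAa; apply: contrapT => npAb.
pose S := [set s | a <= s <= b /\ ~ posdefmx (A s)].
have S0 : S b by split; rewrite ?ab ?lexx.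
have lbS : has_lbound S by exists a => s [/andP[]].
have infS : has_inf S by split => //; exists b.
set t := inf S.
have ta : a <= t by apply: lb_le_inf; [exists b|move=> s [/andP[]]].
have tb : t <= b by exact: ge_inf.
have tab : a <= t <= b by rewrite ta tb.
have lt_posdef s : a <= s -> s < t -> posdefmx (A s).
  move=> as_ st; apply: contrapT => ns; move: (st); apply/negP; rewrite -leNgt.
  by apply: ge_inf => //; split => //; rewrite as_ (ltW (lt_le_trans st tb)).
set F := within `[a, b] (nbhs t); have FF : Filter F by exact: within_filter.
have cAt v : qform (A s) v @[s --> F] --> qform (A t) v.
  by apply: within_continuous_cvg => //; rewrite /= in_itv.
have nsA : \forall s \near F, symmx (A s).
  apply/nbhs_ballP; exists 1 => //= s _ sab; apply: sA.
  by move: sab; rewrite /= in_itv.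
have mA : mxcvg F A (A t) by apply: mxcvg_qform => //; exact: sA.
(* Positive definiteness is an open condition, so the infimum of the failure times is itself a
   failure time. *)
have npAt : ~ posdefmx (A t).
  move=> pAt; have nA := @posdef_near _ _ _ _ FF _ _ nsA mA pAt.
  have [e e0 he] := near_within_itv _ _ _ _ nA.
  have [s [sab ns] st] := inf_adherent e0 infS.
  have ts : t <= s by exact: ge_inf.
  apply: ns; apply: he => //; rewrite distrC ger0_norm ?subr_ge0 //.
  by rewrite ltrBlDl.
have at' : a < t by rewrite lt_neqAle ta andbT; apply/eqP => E'; apply: npAt; rewrite -E'.
have before e : 0 < e -> exists s, [/\ a <= s, s < t & `|t - s| < e].
  move=> e0; exists (Num.max a (t - e / 2)); split.
  - by rewrite le_max lexx.
  - by rewrite gt_max at' ltrBlDr ltrDl divr_gt0.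
  - rewrite ger0_norm ?subr_ge0 ?ge_max ?ta ?lerBlDr ?lerDl ?divr_ge0 ?ltW //.
    by rewrite ltrBlDr addrC -ltrBlDr lt_max; apply/orP; right; lra.
have psd v : 0 <= qform (A t) v.
  rewrite leNgt; apply/negP => neg.
  have nA := @cvgr_lt _ _ _ FF _ _ (cAt v) _ neg.
  have [e e0 he] := near_within_itv _ _ _ _ nA.
  have [s [as_ st ts]] := before _ e0.
  have := he s; rewrite as_ (ltW (lt_le_trans st tb)) => /(_ isT ts).
  by rewrite ltNge posdef_ge0 //; exact: lt_posdef.
have [v v0 qv] : exists2 v, v != 0 & qform (A t) v = 0.
  apply: contrapT => nv; apply: npAt; split; first exact: sA.
  move=> v v0; rewrite lt0r psd andbT; apply/eqP => qv; apply: nv.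
  by exists v.
have Av : A t *m v = 0 by apply: psd_ker => //; exact: sA.
pose phi j s := qform (beta j) v - 2 * dotv (sigma j *m v) (A s *m v)
       - kappa j * dotv (A s *m v) (A s *m v).
have nphi : \forall s \near F, forall j, 0 < phi j s.
  (* There are finitely many protocol pieces, so one neighbourhood of [t] serves all of them,
     whichever is active. *)
  apply: filter_forall => j.
  have mAv : mxcvg F (fun s => A s *m v) (A t *m v).
    by apply: mxcvgM => //; exact: mxcvg_cst.
  have : phi j s @[s --> F] --> phi j t.
    apply: cvgB; first apply: cvgB; first exact: cvg_cst.
      apply: cvgM; first exact: cvg_cst.
      by apply: cvg_dotv => //; exact: mxcvg_cst.
    apply: cvgM; first exact: cvg_cst.
    exact: cvg_dotv.
  move=> /cvgr_gt; apply; rewrite /phi Av !dotv0r !mulr0 !subr0.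
  exact: (pbeta j).2.
have [e e0 he] := near_within_itv _ _ _ _ nphi.
have [s [as_ st ts]] := before _ e0.
have : qform (A s) v <= qform (A t) v.
  apply: (nondecreasing_off_finite E (fun s => qform (A s) v)).
  - exact: ltW.
  - by apply: continuous_subspaceW (cA v); apply: subset_itv; rewrite bnd_simp.
  move=> r /andP[sr rt] rE; have [|j hj] := dA r _ rE.
    by rewrite (le_lt_trans as_ sr) (lt_le_trans rt tb).
  exists (phi j r) => //; apply/ltW/he.
    by rewrite (le_trans as_ (ltW sr)) (ltW (lt_le_trans rt tb)).
  apply: le_lt_trans ts; rewrite !ger0_norm ?subr_ge0 ?(ltW st) ?(ltW rt) //.
  by rewrite lerD2l lerN2 ltW.
by apply/negP; rewrite qv -ltNge (lt_posdef s as_ st).2.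
Qed.

(* With [w_s = M_s^-1 b_s], the increment of the Schur value is [c_s - c_t + w_s^T (M_s - M_t) w_t - (w_s + w_t)^T (b_s - b_t)], so the limit needs only the continuity of [M^-1]. *)
Lemma is_derive_schur_value {R : realType} {d} (M : R -> 'M[R]_d) (b : R -> 'cV[R]_d)
  (c : R -> R) (dM : 'cV[R]_d -> R) (db : 'cV[R]_d -> R) (dc t : R) :
  (\forall s \near t, posdefmx (M s)) ->
  (forall v, is_derive t 1 (fun s => qform (M s) v) (dM v)) ->
  (forall v, is_derive t 1 (fun s => dotv v (b s)) (db v)) ->
  is_derive t 1 c dc ->
  let w := invmx (M t) *m b t in
  is_derive t 1 (fun s => c s - qform (invmx (M s)) (b s)) (dc - 2 * db w + dM w).
Proof.
move=> pM hM hb hc w; apply: cvg_is_derive1.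
set F := 0^'; have FF : ProperFilter F by exact: Proper_dnbhs_numFieldType.
have pMt : posdefmx (M t) := nbhs_singleton pM.
have sMt := pMt.1; have uMt := posdef_unit _ pMt.
have pMh : \forall h \near F, posdefmx (M (h + t)).
  have : \forall h \near (0 : R), posdefmx (M (h + t)).
    have ct : h + t @[h --> (0 : R)] --> t.
      by rewrite -[X in _ --> X]add0r; apply: cvgD; [exact: cvg_id|exact: cvg_cst].
    exact: ct pM.
  exact: cvg_within.
have h0 : h @[h --> F] --> (0 : R) by exact: cvg_within.
have nz : \forall h \near F, h != 0 :> R by exact: nbhs_dnbhs_neq.
pose Q h : 'M[R]_d := h^-1 *: (M (h + t) - M t).
pose Qb h : 'cV[R]_d := h^-1 *: (b (h + t) - b t).
have hQ v : qform (Q h) v @[h --> F] --> dM v.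
  under eq_cvg => h do rewrite /Q qform_mxZ qform_mxD qform_mxN.
  exact: is_derive1_cvg (hM v).
have sQ : \forall h \near F, symmx (Q h).
  near=> h; apply/symmxZ/symmxD; last exact: symmxN.
  by have [] : posdefmx (M (h + t)) by near: h.
have fF : Filter F by exact: filter_filter.
(* The derivatives are given only as functions of [v]; a matrix and a vector representing them are
   rebuilt so that the limit can be taken inside matrix products. *)
have mQ := @mxcvg_polar _ _ _ F fF Q dM sQ hQ; set dMm := \matrix_(_, _) _ in mQ.
have dMmE v : qform dMm v = dM v.
  apply: (cvg_unique _ _ (hQ v)) => //.
  by apply: cvg_dotv; [exact: mxcvg_cst|apply: mxcvgM => //; exact: mxcvg_cst].
have hQb v : dotv v (Qb h) @[h --> F] --> db v.
  under eq_cvg => h do rewrite /Qb dotvZr dotvBr.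
  exact: is_derive1_cvg (hb v).
have mQb : mxcvg F Qb (\col_i db (ebasis i)).
  move=> i j; rewrite ord1 mxE.
  by under eq_cvg => h do rewrite -(dotv_ebasis i); exact: hQb.
set dbv := \col__ _ in mQb.
have dbvE v : dotv v dbv = db v.
  apply: (cvg_unique _ _ (hQb v)) => //.
  by apply: cvg_dotv => //; exact: mxcvg_cst.
(* Differentiability implies continuity: the increment is [h] times a convergent quotient. *)
have cont m n (X0 : 'M[R]_(m, n)) (Y : R -> 'M[R]_(m, n)) L : mxcvg F Y L ->
    mxcvg F (fun h => X0 + h *: Y h) X0.
  move=> hY i j; under eq_cvg do rewrite !mxE.
  suff : X0 i j + h * Y h i j @[h --> F] --> X0 i j + 0 * L i j by rewrite mul0r addr0.
  by apply: cvgD; [exact: cvg_cst|apply: cvgM => //; exact: hY].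
have eqM m n (Y : R -> 'M[R]_(m, n)) : \forall h \near F,
    Y t + h *: (h^-1 *: (Y (h + t) - Y t)) = Y (h + t).
  near=> h; rewrite scalerA divff ?scale1r; last by near: h.
  by rewrite addrC subrK.
have mxeq m n (X Y : R -> 'M[R]_(m, n)) L : (\forall h \near F, X h = Y h) ->
    mxcvg F X L -> mxcvg F Y L.
  move=> XY hX i j; apply: cvg_trans (hX i j); apply: near_eq_cvg.
  by near=> h; have -> : X h = Y h by near: h.
have mM : mxcvg F (fun h => M (h + t)) (M t).
  by apply: (mxeq _ _ _ _ _ (eqM _ _ M)); apply: cont mQ.
have mb : mxcvg F (fun h => b (h + t)) (b t).
  by apply: (mxeq _ _ _ _ _ (eqM _ _ b)); apply: cont mQb.
have mw : mxcvg F (fun h => invmx (M (h + t)) *m b (h + t)) w.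
  apply: mxcvgM => //; apply: mxcvg_inv => //.
  by near=> h; apply: posdef_unit; near: h.
apply: (@cvg_trans _ (h^-1 * (c (h + t) - c t)
   + dotv (invmx (M (h + t)) *m b (h + t)) (Q h *m w) - dotv w (Qb h)
   - dotv (invmx (M (h + t)) *m b (h + t)) (Qb h) @[h --> F])).
  apply: near_eq_cvg; near=> h.
  have pMs : posdefmx (M (h + t)) by near: h.
  have uMs := posdef_unit _ pMs; have sMs := pMs.1.
  rewrite /Q /Qb -scalemxAl !dotvZr !dotvBr mulmxBl !dotvBr.
  rewrite (dotv_sym _ _ w sMs) /w !mulKVmx // /qform.
  by rewrite (dotvC (b (h + t)) (invmx (M (h + t)) *m _)) (dotvC (b t)); ring.
rewrite (_ : dc - 2 * db w + dM w = dc + dotv w (dMm *m w) - dotv w dbv - dotv w dbv).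
  apply: cvgB; first apply: cvgB; first apply: cvgD.
  - exact: is_derive1_cvg.
  - by apply: cvg_dotv => //; apply: mxcvgM => //; exact: mxcvg_cst.
  - by apply: cvg_dotv => //; exact: mxcvg_cst.
  - exact: cvg_dotv.
by rewrite -/(qform dMm w) dMmE dbvE; ring.
Unshelve. all: by end_near. Qed.

Lemma within_cvg_at_left {R : realType} (S : set R) (f : R -> R) (t : R) :
  S t -> (\forall s \near t^'-, S s) -> {within S, continuous f} ->
  f s @[s --> t^'-] --> f t.
Proof.
move=> St nS cf P /(within_continuous_cvg S f t St cf) nP.
have nP' : \forall s \near t^'-, S s -> P (f s).
  exact: (@filterS _ (nbhs t) _ _ _ (fun s h _ => h) nP).
by apply: filterS2 nP' nS => s; apply.
Qed.

(** In the last inequality the right side is the quadratic part of minus twice the logarithm of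
    [G+_t(x|x0) G-_t(x|y)]. The bound holds for all [x], hence for the minimising one, where it
    becomes a bound on the Schur complement. *)
Lemma riccati_coupling {R : realType} {d n} (T : R) (E : seq R)
  (beta sigma : 'I_n -> 'M[R]_d) (kappa : 'I_n -> R) (Ap Am B C : R -> 'M[R]_d) :
  0 < T -> (forall j, posdefmx (beta j)) ->
  (forall t, 0 < t <= T -> symmx (Ap t)) ->
  (forall t, 0 <= t < T -> symmx (Am t)) ->
  (forall v, {within [set s | 0 < s <= T], continuous (fun s => qform (Ap s) v)}) ->
  (forall v, {within [set s | 0 <= s < T], continuous (fun s => qform (Am s) v)}) ->
  (forall v w, {within [set s | 0 <= s < T], continuous (fun s => dotv v (B s *m w))}) ->
  (forall v, {within [set s | 0 <= s < T], continuous (fun s => qform (C s) v)}) ->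
  (forall t, 0 < t < T -> t \notin E -> exists j,
    [/\ forall v, is_derive t 1 (fun s => qform (Ap s) v)
          (qform (beta j) v - 2 * dotv (sigma j *m v) (Ap t *m v)
           - kappa j * dotv (Ap t *m v) (Ap t *m v)),
        forall v, is_derive t 1 (fun s => qform (Am s) v)
          (- qform (beta j) v - 2 * dotv (sigma j *m v) (Am t *m v)
           + kappa j * dotv (Am t *m v) (Am t *m v)),
        forall v w, is_derive t 1 (fun s => dotv v (B s *m w))
          (- dotv (sigma j *m v) (B t *m w)
           + kappa j * dotv (Am t *m v) (B t *m w))
      & forall v, is_derive t 1 (fun s => qform (C s) v)
          (kappa j * dotv (B t *m v) (B t *m v))]) ->
  (\forall s \near T^'-, posdefmx (Am s)) ->
  (\forall s \near 0^'+, posdefmx (Ap s)) ->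
  (forall D, posdefmx D -> forall y,
     qform (C s) y - qform (invmx (Am s + D)) (B s *m y) @[s --> T^'-] --> qform D y) ->
  forall t, 0 < t < T -> [/\ posdefmx (Ap t), posdefmx (Am t) &
    forall x y, qform (Ap T) y <=
      qform (Ap t + Am t) x - 2 * dotv x (B t *m y) + qform (C t) y].
Proof.
move=> T0 pbeta sAp sAm cAp cAm cB cC dyn nAm nAp lim.
have pAp t : 0 < t <= T -> posdefmx (Ap t).
  move=> /andP[t0 tT].
  have [s [[s0 st] pAs]] := filter_ex (filterI (filterI (nbhs_right_gt 0) (nbhs_right_lt t0)) nAp).
  apply: (posdef_riccati E Ap s t beta sigma kappa) => //.
  - exact: ltW.
  - by move=> r /andP[sr rt]; apply: sAp; rewrite (lt_le_trans s0 sr) (le_trans rt tT).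
  - move=> v; apply: continuous_subspaceW (cAp v) => r /=; rewrite in_itv /=.
    by move=> /andP[sr rt]; rewrite (lt_le_trans s0 sr) (le_trans rt tT).
  move=> r /andP[sr rt] rE; have [|j [h _ _ _]] := dyn r _ rE; last by exists j.
  by rewrite (lt_trans s0 sr) (lt_le_trans rt tT).
have pAm t : 0 < t < T -> posdefmx (Am t).
  move=> /andP[t0 tT].
  have [s [[sT st] pAs]] := filter_ex (filterI (filterI (nbhs_left_lt T) (nbhs_left_gt tT)) nAm).
  rewrite -[t]opprK.
  (* Time reversal: [r |-> Am (- r)] satisfies the forward Riccati equation with [sigma] replaced by
     [- sigma]. *)
  apply: (posdef_riccati (map -%R E) (fun r => Am (- r)) (- s) (- t) beta (fun j => - sigma j) kappa) => //.
  - by rewrite lerN2 ltW.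
  - move=> r /andP[sr rt]; apply: sAm.
    by rewrite lerNr oppr0 ltrNl (lt_le_trans _ sr) ?ltrN2 // (le_trans rt) // oppr_le0 ltW.
  - move=> v; apply: (within_continuous_compN (f := fun s => qform (Am s) v)).
    rewrite !opprK; apply: continuous_subspaceW (cAm v) => r /=; rewrite in_itv /=.
    by move=> /andP[tr rs]; rewrite (le_trans (ltW t0) tr) (le_lt_trans rs sT).
  - move=> r /andP[sr rt] rE; have [||j [_ h _ _]] := dyn (- r).
    + by rewrite oppr_gt0 ltrNl (lt_trans rt) ?oppr_lt0 // (lt_trans _ sr) // ltrN2.
    + by apply: contra rE => rE; rewrite -[r]opprK; exact: map_f.
    exists j => v; have hN : is_derive r 1 (-%R : R -> R) (-1) by exact: is_deriveNid.
    have := is_derive1_comp (h v) hN => /is_derive_eq; apply.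
    by rewrite !mulNmx !dotvNl; ring.
  - by rewrite opprK.
move=> t /andP[t0 tT]; split; first by apply: pAp; rewrite t0 ltW.
  by apply: pAm; rewrite t0.
pose M s := Ap s + Am s.
have pM s : 0 < s < T -> posdefmx (M s).
  by move=> /andP[s0 sT]; apply: posdefD; [apply: pAp; rewrite s0 ltW|apply: pAm; rewrite s0].
pose q y s := qform (C s) y - qform (invmx (M s)) (B s *m y).
have open_near s : 0 < s < T -> \forall r \near s, 0 < r < T.
  move=> /andP[s0 sT]; near=> r; apply/andP; split; near: r.
    exact: lt_nbhsr.
  exact: lt_nbhsl.
have cq y s : t <= s < T -> {within `[t, s], continuous (q y)}.
  move=> /andP[ts sT]; apply/subspace_continuousP => r; rewrite /= in_itv /=.
  move=> /andP[tr rs].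
  have r0T : 0 < r < T by rewrite (lt_le_trans t0 tr) (le_lt_trans rs sT).
  have sub f (S : set R) : `[t, s] `<=` S -> {within S, continuous f} ->
      f u @[u --> within `[t, s] (nbhs r)] --> (f r : R).
    move=> tsS cf; apply: within_continuous_cvg; first by rewrite /= in_itv /= tr.
    exact: continuous_subspaceW cf.
  have ts1 : `[t, s] `<=` [set s | 0 < s <= T].
    by move=> u /=; rewrite in_itv /= => /andP[tu us]; rewrite (lt_le_trans t0 tu) (le_trans us (ltW sT)).
  have ts2 : `[t, s] `<=` [set s | 0 <= s < T].
    by move=> u /=; rewrite in_itv /= => /andP[tu us]; rewrite (le_trans (ltW t0) tu) (le_lt_trans us sT).
  set F := within _ _; have FF : Filter F by exact: within_filter.
  have inF (P : set R) : (forall u, 0 < u < T -> P u) -> \forall u \near F, P u.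
    move=> hP; apply/nbhs_ballP; exists 1 => //= u _; rewrite in_itv /= => /andP[tu us].
    by apply: hP; rewrite (lt_le_trans t0 tu) (le_lt_trans us sT).
  have mB : mxcvg F (fun u => B u *m y) (B r *m y).
    move=> i j; rewrite ord1; under eq_cvg => u do rewrite -(dotv_ebasis i).
    by rewrite -(dotv_ebasis i); exact: sub (cB _ _).
  have mM : mxcvg F M (M r).
    apply: mxcvg_qform; first by apply: inF => u /pM[].
      by case: (pM r r0T).
    move=> v; rewrite /M qform_mxD; under eq_cvg => u do rewrite qform_mxD.
    by apply: cvgD; [exact: sub (cAp v)|exact: sub (cAm v)].
  apply: cvgB; first exact: sub (cC y).
  apply: cvg_dotv => //; apply: mxcvgM => //; apply: mxcvg_inv => //.
    exact/posdef_unit/pM.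
  by apply: inF => u /pM/posdef_unit.
have q_le y s : t <= s < T -> q y s <= q y t.
  move=> tsT; move: (tsT) => /andP[ts sT]; rewrite -lerN2.
  apply: (nondecreasing_off_finite E (fun s => - q y s)) => //.
    by move=> r; apply: cvgN; exact: cq.
  move=> r /andP[tr rs] rE.
  have r0T : 0 < r < T by rewrite (lt_trans t0 tr) (lt_trans rs sT).
  have [j [hAp hAm hB hC]] := dyn r r0T rE.
  have nM : \forall u \near r, posdefmx (M u).
    by apply: filterS (open_near r r0T) => u /pM.
  exists 0 => //.
  pose dMv v := - 2 * dotv (sigma j *m v) (M r *m v)
    + kappa j * (dotv (Am r *m v) (Am r *m v) - dotv (Ap r *m v) (Ap r *m v)).
  have hM v : is_derive r 1 (fun u => qform (M u) v) (dMv v).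
    rewrite (_ : (fun u => _) = (fun u => qform (Ap u) v + qform (Am u) v)); last first.
      by apply/funext => u; rewrite /M qform_mxD.
    have := is_derive1D _ _ _ _ _ (hAp v) (hAm v) => /is_derive_eq; apply.
    by rewrite /dMv /M !dotvlin; ring.
  have hq := is_derive_schur_value M (fun u => B u *m y) (fun u => qform (C u) y)
    _ _ _ r nM hM (fun v => hB v y) (hC y).
  have := is_derive1N _ _ _ hq => /is_derive_eq; apply.
  set w := invmx _ *m _; rewrite /dMv.
  (* With [M w = B y] the [sigma] terms cancel, and what remains is
     [kappa (|B y - Am w|^2 - |Ap w|^2)], which vanishes since [B y - Am w = Ap w]. *)
  have Mw : M r *m w = B r *m y by rewrite mulKVmx //; exact/posdef_unit/pM.
  rewrite Mw; have -> : B r *m y = Ap r *m w + Am r *m w by rewrite -mulmxDl.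
  by rewrite !dotvlin (dotvC (Ap r *m w) (Am r *m w)); ring.
move=> x y; apply: (@le_trans _ _ (q y t)); last first.
  have := inv_qform_ge _ (B t *m y) x (pM t _); rewrite t0 => /(_ tT).
  by rewrite dotvC /q /M; lra.
set p := qform (Ap T) y.
have pApT : posdefmx (Ap T) by apply: pAp; rewrite T0 lexx.
have p0 : 0 <= p by exact: posdef_ge0.
(* For [s < T] nothing ensures [Ap s >= Ap T]. The factor [1 - e] leaves room: [Ap s - (1 - e) Ap T]
   tends to the positive definite [e Ap T], so [M s] dominates [Am s + D] with [D = (1 - e) Ap T],
   and inversion reverses the order. *)
have small e : 0 < e < 1 -> (1 - e) * p <= q y t.
  move=> /andP[e0 e1]; have pD : posdefmx ((1 - e) *: Ap T).
    by apply: posdefZ => //; rewrite subr_gt0.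
  rewrite -qform_mxZ; apply: (cvgr_to_le (lim _ pD y)).
  have nT : \forall s \near T^'-, 0 < s <= T.
    by near=> s; apply/andP; split; [near: s; exact: nbhs_left_gt|near: s; exact: nbhs_left_le].
  have mAp : mxcvg T^'- (fun s => Ap s - (1 - e) *: Ap T) (Ap T - (1 - e) *: Ap T).
    apply: mxcvgB; last exact: mxcvg_cst.
    apply: mxcvg_qform; [by apply: filterS nT => s /sAp|exact: pApT.1|].
    by move=> v; apply: within_cvg_at_left (cAp v) => //=; rewrite T0 lexx.
  have nAp' : \forall s \near T^'-, posdefmx (Ap s - (1 - e) *: Ap T).
    apply: posdef_near mAp _.
      apply: filterS nT => s /sAp sA.
      by apply: symmxD => //; apply: symmxN; apply: symmxZ; exact: pApT.1.
    rewrite -{1}[Ap T]scale1r -scalerBl subKr.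
    exact: posdefZ.
  near=> s.
  have sT : s < T by near: s; exact: nbhs_left_lt.
  have ts : t < s by near: s; exact: nbhs_left_gt.
  have s0T : 0 < s < T by rewrite (lt_trans t0 ts).
  apply: le_trans (q_le y s _); last by rewrite (ltW ts).
  rewrite /q lerD2l lerN2; apply: inv_qform_antimono; first exact: pM.
    by apply: posdefD => //; near: s.
  move=> v; rewrite /M addrC -[Ap s](subrK ((1 - e) *: Ap T)) -addrA.
  rewrite [X in _ <= X]qform_mxD [_ + Am s]addrC lerDr.
  by apply: posdef_ge0; near: s.
rewrite leNgt; apply/negP => qp.
(* This [e] satisfies [2 e (p + 1) <= p - q y t], whereas [small] yields [p - q y t <= e p]. The
   bound [1/2] keeps [e] below 1, and [p + 1] keeps the quotient defined when [p = 0]. *)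
have e0 : 0 < Num.min (2^-1) ((p - q y t) / (2 * (p + 1))) < 1.
  rewrite lt_min invr_gt0 ltr0n /= divr_gt0 ?subr_gt0 ?mulr_gt0 //=; last by lra.
  by rewrite gt_min; apply/orP; left; lra.
have := small _ e0; set e := Num.min _ _ in e0 *.
have : e * (2 * (p + 1)) <= p - q y t.
  by rewrite -ler_pdivlMr ?ge_min ?lexx ?orbT // mulr_gt0 //; lra.
move: e0 => /andP[e0 _]; have : 0 <= e * p by rewrite mulr_ge0 // ltW.
by lra.
Unshelve. all: by end_near. Qed.

(** * From the Green equations to the Riccati system *)

Lemma is_derive_line {R : realType} {d} (f : 'cV[R]_d -> R) (x v : 'cV[R]_d) (df : R) :
  is_derive (0 : R) 1 (fun h : R => f (h *: v + x)) df -> is_derive x v f df.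
Proof.
move=> /is_derive1_cvg hf.
have hf' : h^-1 *: ((f \o shift x) (h *: v) - f x) @[h --> 0^'] --> df.
  by move: hf; under eq_cvg => h do rewrite addr0 scale0r add0r.
by apply: DeriveDef; [apply/cvg_ex; exists df|exact: cvg_lim hf'].
Qed.

Lemma is_derive_quad {R : realType} (a b c : R) :
  is_derive (0 : R) 1 (fun h => a + h * b + h ^+ 2 * c) b.
Proof.
apply: cvg_is_derive1.
apply: (@cvg_trans _ (b + h * c @[h --> 0^'])).
  apply: near_eq_cvg; near=> h; rewrite addr0 mul0r expr0n mul0r !addr0.
  have h0 : h != 0 by near: h; exact: nbhs_dnbhs_neq.
  by field.
suff : b + h * c @[h --> 0^'] --> b + 0 * c by rewrite mul0r addr0.
apply: cvgD; first exact: cvg_cst.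
by apply: cvgM; [exact: cvg_within|exact: cvg_cst].
Unshelve. all: by end_near. Qed.

Definition gexpo {R : realType} {d} (A B C : 'M[R]_d) (thx thy : 'cV[R]_d) (ze : R)
  (x y : 'cV[R]_d) : R :=
  - qform A x / 2 + dotv x (B *m y) - qform C y / 2 + dotv thx x + dotv thy y + ze.

Definition ggrad {R : realType} {d} (A B : 'M[R]_d) (thx x y : 'cV[R]_d) : 'cV[R]_d :=
  - (A *m x) + B *m y + thx.

Lemma gexp_gt0 {R : realType} {d} (A B C : 'M[R]_d) thx thy ze x y :
  0 < gexp A B C thx thy ze x y.
Proof. exact: expR_gt0. Qed.

(** Along a line the exponent is a quadratic polynomial in [h], so spatial derivatives reduce to
    [is_derive_quad]. *)
Lemma gexpo_line {R : realType} {d} (A B C : 'M[R]_d) thx thy ze x y v h : symmx A ->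
  gexpo A B C thx thy ze (h *: v + x) y =
  gexpo A B C thx thy ze x y + h * dotv v (ggrad A B thx x y) + h ^+ 2 * (- qform A v / 2).
Proof.
move=> sA; rewrite /gexpo /ggrad qformD // qformZ !dotvlin (dotvC v thx).
by field.
Qed.

Lemma is_derive_gexp {R : realType} {d} (A B C : 'M[R]_d) thx thy ze x y v : symmx A ->
  is_derive x v (fun z => gexp A B C thx thy ze z y)
    (gexp A B C thx thy ze x y * dotv v (ggrad A B thx x y)).
Proof.
move=> sA; apply: is_derive_line.
rewrite (_ : (fun h => _) = expR \o (fun h : R => gexpo A B C thx thy ze x y
  + h * dotv v (ggrad A B thx x y) + h ^+ 2 * (- qform A v / 2))); last first.
  by apply/funext => h; rewrite /= -gexpo_line.
apply: is_derive1_comp; last exact: is_derive_quad.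
by apply: is_derive_eq; rewrite mul0r expr0n mul0r !addr0.
Qed.

Lemma is_derive_ggrad {R : realType} {d} (A B : 'M[R]_d) thx x y v :
  is_derive x v (fun z => dotv v (ggrad A B thx z y)) (- qform A v).
Proof.
apply: is_derive_line.
rewrite (_ : (fun h => _) = (fun h : R => dotv v (ggrad A B thx x y)
  + h * (- qform A v) + h ^+ 2 * 0)); first exact: is_derive_quad.
apply/funext => h; rewrite /ggrad mulmxDr -scalemxAr !dotvlin /qform; ring.
Qed.

Lemma grad_gexp {R : realType} {d} (A B C : 'M[R]_d) thx thy ze x y : symmx A ->
  grad (fun z => gexp A B C thx thy ze z y) x =
  gexp A B C thx thy ze x y *: ggrad A B thx x y.
Proof.
move=> sA; apply/matrixP => i j; rewrite ord1 !mxE.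
rewrite (@derive_val _ _ _ _ _ _ _ (is_derive_gexp A B C thx thy ze x y (ebasis i) sA)).
by rewrite dotv_ebasis !mxE.
Qed.

Lemma mxtrace_qform {R : realType} {d} (A : 'M[R]_d) :
  \tr A = \sum_i qform A (ebasis i).
Proof.
by apply: eq_bigr => i _; rewrite /qform dotv_ebasis /ebasis -colE mxE.
Qed.

(** For [G = e^g] the Laplacian is [G (|grad g|^2 + lap g)], and here [lap g = - tr A]. *)
Lemma lap_gexp {R : realType} {d} (A B C : 'M[R]_d) thx thy ze x y : symmx A ->
  lap (fun z => gexp A B C thx thy ze z y) x =
  gexp A B C thx thy ze x y *
    (dotv (ggrad A B thx x y) (ggrad A B thx x y) - \tr A).
Proof.
move=> sA; rewrite mxtrace_qform -sumrB mulr_sumr; apply: eq_bigr => i _.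
rewrite (_ : 'D_(ebasis i) (fun z => gexp A B C thx thy ze z y) =
  (fun z => gexp A B C thx thy ze z y) * (fun z => dotv (ebasis i) (ggrad A B thx z y))); last first.
  apply/funext => z.
  exact: (@derive_val _ _ _ _ _ _ _ (is_derive_gexp A B C thx thy ze z y (ebasis i) sA)).
have h1 := is_derive_gexp A B C thx thy ze x y (ebasis i) sA.
have h2 := is_derive_ggrad A B thx x y (ebasis i).
rewrite (@derive_val _ _ _ _ _ _ _ (is_deriveM h1 h2)).
rewrite !dotv_ebasis /GRing.scale /=; ring.
Qed.

Lemma divg_gexp {R : realType} {d} (A B C : 'M[R]_d) thx thy ze x y (sigma : 'M[R]_d) :
  symmx A ->
  divg (fun z => gexp A B C thx thy ze z y *: (sigma *m z)) x =
  gexp A B C thx thy ze x y *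
    (dotv (sigma *m x) (ggrad A B thx x y) + \tr sigma).
Proof.
move=> sA; rewrite -big_split mulr_sumr; apply: eq_bigr => i _.
rewrite (_ : (fun z => _) =
  (fun z => gexp A B C thx thy ze z y) * (fun z : 'cV_d => (sigma *m z) i 0)); last first.
  by apply/funext => z; rewrite mxE.
have h1 := is_derive_gexp A B C thx thy ze x y (ebasis i) sA.
have h2 : is_derive x (ebasis i) (fun z : 'cV_d => (sigma *m z) i 0) (sigma i i).
  apply: is_derive_line; rewrite (_ : (fun h => _) = (fun h : R => (sigma *m x) i 0
    + h * sigma i i + h ^+ 2 * 0)); first exact: is_derive_quad.
  apply/funext => h; rewrite mulmxDr -scalemxAr mulr0 addr0 addrC.
  by rewrite /ebasis -colE mxE [in LHS]mxE mxE; congr (_ + _); rewrite mxE.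
rewrite (@derive_val _ _ _ _ _ _ _ (is_deriveM h1 h2)).
rewrite !dotv_ebasis /GRing.scale /=; ring.
Qed.

Lemma is_derive_ln {R : realType} (f : R -> R) (t df : R) : 0 < f t ->
  is_derive t 1 f (f t * df) -> is_derive t 1 (@ln R \o f) df.
Proof.
move=> f0 hf; have := is_derive1_comp (is_derive1_ln f0) hf => /is_derive_eq.
by apply; rewrite mulKf // gt_eqF.
Qed.

(** Differentiability in time is assumed for the Green function, not for its coefficients; the
    logarithm passes it on to the exponent. *)
Lemma is_derive_gexpo {R : realType} {d} (A B C : R -> 'M[R]_d) (thx thy : R -> 'cV[R]_d)
  (ze : R -> R) (x y : 'cV[R]_d) (t dG : R) :
  is_derive t 1 (fun s => gexp (A s) (B s) (C s) (thx s) (thy s) (ze s) x y)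
    (gexp (A t) (B t) (C t) (thx t) (thy t) (ze t) x y * dG) ->
  is_derive t 1 (fun s => gexpo (A s) (B s) (C s) (thx s) (thy s) (ze s) x y) dG.
Proof.
move=> hG; rewrite (_ : (fun s => _) = @ln R \o
  (fun s => gexp (A s) (B s) (C s) (thx s) (thy s) (ze s) x y)); last first.
  by apply/funext => s; rewrite /= expRK.
by apply: is_derive_ln hG; exact: gexp_gt0.
Qed.

(** A second difference, in which linear and constant terms cancel. This formula and the next two
    share one four-term shape so that one differentiation rule and one continuity rule handle all
    three coefficients. *)
Lemma qformA_gexpo {R : realType} {d} (A B C : 'M[R]_d) thx thy ze x :
  qform A x = (gexpo A B C thx thy ze 0 0 + gexpo A B C thx thy ze 0 0)
    + (- gexpo A B C thx thy ze x 0 + - gexpo A B C thx thy ze (- x) 0).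
Proof. by rewrite /gexpo qformN qform0 !dotvlin; field. Qed.

Lemma dotvB_gexpo {R : realType} {d} (A B C : 'M[R]_d) thx thy ze x y :
  dotv x (B *m y) = (gexpo A B C thx thy ze x y + gexpo A B C thx thy ze 0 0)
    + (- gexpo A B C thx thy ze x 0 + - gexpo A B C thx thy ze 0 y).
Proof. by rewrite /gexpo !qform0 !dotvlin; field. Qed.

Lemma qformC_gexpo {R : realType} {d} (A B C : 'M[R]_d) thx thy ze y :
  qform C y = (gexpo A B C thx thy ze 0 0 + gexpo A B C thx thy ze 0 0)
    + (- gexpo A B C thx thy ze 0 y + - gexpo A B C thx thy ze 0 (- y)).
Proof. by rewrite /gexpo qformN !qform0 !dotvlin; field. Qed.

Lemma is_derive1_4 {R : realType} (f1 f2 f3 f4 : R -> R) (t d1 d2 d3 d4 : R) :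
  is_derive t 1 f1 d1 -> is_derive t 1 f2 d2 ->
  is_derive t 1 f3 d3 -> is_derive t 1 f4 d4 ->
  is_derive t 1 (fun s => (f1 s + f2 s) + (- f3 s + - f4 s)) ((d1 + d2) + (- d3 + - d4)).
Proof.
move=> h1 h2 h3 h4; exact: (is_derive1D _ _ _ _ _ (is_derive1D _ _ _ _ _ h1 h2)
  (is_derive1D _ _ _ _ _ (is_derive1N _ _ _ h3) (is_derive1N _ _ _ h4))).
Qed.

Lemma within_continuous4 {R : realType} (S : set R) (f1 f2 f3 f4 : R -> R) :
  {within S, continuous f1} -> {within S, continuous f2} ->
  {within S, continuous f3} -> {within S, continuous f4} ->
  {within S, continuous (fun s => (f1 s + f2 s) + (- f3 s + - f4 s))}.
Proof.
move=> h1 h2 h3 h4 s; apply: cvgD; first exact: cvgD (h1 s) (h2 s).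
by apply: cvgD; [exact: cvgN (h3 s)|exact: cvgN (h4 s)].
Qed.

Lemma backward_riccati {R : realType} {d} (A B C : R -> 'M[R]_d) (thx thy : R -> 'cV[R]_d)
  (ze : R -> R) (beta sigma : 'M[R]_d) (nu : 'cV[R]_d) (kappa t : R) :
  let G s x y := gexp (A s) (B s) (C s) (thx s) (thy s) (ze s) x y in
  symmx (A t) ->
  (forall x y, derivable (fun s => G s x y) t 1 /\
     - 'D_1 (fun s => G s x y) t + qform beta (x - nu) / 2 * G t x y
       = dotv (sigma *m x) (grad (fun z => G t z y) x)
         + kappa / 2 * lap (fun z => G t z y) x) ->
  [/\ forall v, is_derive t 1 (fun s => qform (A s) v)
          (- qform beta v - 2 * dotv (sigma *m v) (A t *m v)
           + kappa * dotv (A t *m v) (A t *m v)),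
      forall v w, is_derive t 1 (fun s => dotv v (B s *m w))
          (- dotv (sigma *m v) (B t *m w) + kappa * dotv (A t *m v) (B t *m w))
    & forall v, is_derive t 1 (fun s => qform (C s) v)
          (kappa * dotv (B t *m v) (B t *m v))].
Proof.
move=> G sA hG.
pose g x y := ggrad (A t) (B t) (thx t) x y.
(* The time derivative of [log G], read off by dividing the backward equation by [G]. *)
pose l x y := qform beta (x - nu) / 2 - dotv (sigma *m x) (g x y)
  - kappa / 2 * (dotv (g x y) (g x y) - \tr (A t)).
have hL x y : is_derive t 1
    (fun s => gexpo (A s) (B s) (C s) (thx s) (thy s) (ze s) x y) (l x y).
  have [dG eG] := hG x y; apply: is_derive_gexpo.
  apply: (is_derive_eq (derivableP dG)).
  move: eG; rewrite grad_gexp // lap_gexp // dotvZr /l /g -/(G t x y).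
  by move: (derive _ _ _) => D eD; lra.
split=> [v|v w|v].
- under eq_fun => s do rewrite (qformA_gexpo _ (B s) (C s) (thx s) (thy s) (ze s)).
  have := is_derive1_4 _ _ _ _ _ _ _ _ _ (hL 0 0) (hL 0 0) (hL v 0) (hL (- v) 0).
  move=> /is_derive_eq; apply.
  rewrite /l /g /ggrad /qform !dotvlin (dotvC (thx t)); by field.
- under eq_fun => s do rewrite (dotvB_gexpo (A s) _ (C s) (thx s) (thy s) (ze s)).
  have := is_derive1_4 _ _ _ _ _ _ _ _ _ (hL v w) (hL 0 0) (hL v 0) (hL 0 w).
  move=> /is_derive_eq; apply.
  rewrite /l /g /ggrad /qform !dotvlin (dotvC (thx t)) (dotvC (B t *m w)); by field.
- under eq_fun => s do rewrite (qformC_gexpo (A s) (B s) _ (thx s) (thy s) (ze s)).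
  have := is_derive1_4 _ _ _ _ _ _ _ _ _ (hL 0 0) (hL 0 0) (hL 0 v) (hL 0 (- v)).
  move=> /is_derive_eq; apply.
  rewrite /l /g /ggrad /qform !dotvlin (dotvC (thx t)); by field.
Qed.

Lemma forward_riccati {R : realType} {d} (A B C : R -> 'M[R]_d) (thx thy : R -> 'cV[R]_d)
  (ze : R -> R) (beta sigma : 'M[R]_d) (nu : 'cV[R]_d) (kappa t : R) :
  let G s x y := gexp (A s) (B s) (C s) (thx s) (thy s) (ze s) x y in
  symmx (A t) ->
  (forall x y, derivable (fun s => G s x y) t 1 /\
     'D_1 (fun s => G s x y) t + qform beta (x - nu) / 2 * G t x y
       = - divg (fun z => G t z y *: (sigma *m z)) x
         + kappa / 2 * lap (fun z => G t z y) x) ->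
  forall v, is_derive t 1 (fun s => qform (A s) v)
          (qform beta v - 2 * dotv (sigma *m v) (A t *m v)
           - kappa * dotv (A t *m v) (A t *m v)).
Proof.
move=> G sA hG.
pose g x y := ggrad (A t) (B t) (thx t) x y.
(* The forward equation divided by [G]; the divergence contributes the extra [\tr sigma], which is
   constant in [x] and disappears in second differences. *)
pose l x y := - qform beta (x - nu) / 2 - (dotv (sigma *m x) (g x y) + \tr sigma)
  + kappa / 2 * (dotv (g x y) (g x y) - \tr (A t)).
have hL x y : is_derive t 1
    (fun s => gexpo (A s) (B s) (C s) (thx s) (thy s) (ze s) x y) (l x y).
  have [dG eG] := hG x y; apply: is_derive_gexpo.
  apply: (is_derive_eq (derivableP dG)).
  move: eG; rewrite divg_gexp // lap_gexp // /l /g -/(G t x y).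
  by move: (derive _ _ _) => D eD; lra.
move=> v; under eq_fun => s do rewrite (qformA_gexpo _ (B s) (C s) (thx s) (thy s) (ze s)).
have := is_derive1_4 _ _ _ _ _ _ _ _ _ (hL 0 0) (hL 0 0) (hL v 0) (hL (- v) 0).
move=> /is_derive_eq; apply.
rewrite /l /g /ggrad /qform !dotvlin (dotvC (thx t)); by field.
Qed.

Lemma within_continuous_gexpo {R : realType} {d} (S : set R) (A B C : R -> 'M[R]_d)
  (thx thy : R -> 'cV[R]_d) (ze : R -> R) (x y : 'cV[R]_d) :
  {within S, continuous (fun s => gexp (A s) (B s) (C s) (thx s) (thy s) (ze s) x y)} ->
  {within S, continuous (fun s => gexpo (A s) (B s) (C s) (thx s) (thy s) (ze s) x y)}.
Proof.
move=> cG; rewrite (_ : (fun s => gexpo _ _ _ _ _ _ _ _) = @ln R \o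
  (fun s => gexp (A s) (B s) (C s) (thx s) (thy s) (ze s) x y)); last first.
  by apply/funext => s; rewrite /= expRK.
apply: within_continuous_comp => // _ /set_mem[s _ <-].
by apply: continuous_ln; exact: gexp_gt0.
Qed.

Lemma within_continuous_coeffs {R : realType} {d} (S : set R) (A B C : R -> 'M[R]_d)
  (thx thy : R -> 'cV[R]_d) (ze : R -> R) :
  (forall x y,
    {within S, continuous (fun s => gexp (A s) (B s) (C s) (thx s) (thy s) (ze s) x y)}) ->
  [/\ forall v, {within S, continuous (fun s => qform (A s) v)},
      forall v w, {within S, continuous (fun s => dotv v (B s *m w))}
    & forall v, {within S, continuous (fun s => qform (C s) v)}].
Proof.
pose L x y s := gexpo (A s) (B s) (C s) (thx s) (thy s) (ze s) x y.
move=> cG; have cL x y : {within S, continuous (L x y)}.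
  exact: within_continuous_gexpo.
split=> [v|v w|v].
- have -> : (fun s => qform (A s) v) =
      (fun s => (L 0 0 s + L 0 0 s) + (- L v 0 s + - L (- v) 0 s)).
    by apply/funext => s; exact: qformA_gexpo.
  exact: within_continuous4.
- have -> : (fun s => dotv v (B s *m w)) =
      (fun s => (L v w s + L 0 0 s) + (- L v 0 s + - L 0 w s)).
    by apply/funext => s; exact: dotvB_gexpo.
  exact: within_continuous4.
- have -> : (fun s => qform (C s) v) =
      (fun s => (L 0 0 s + L 0 0 s) + (- L 0 v s + - L 0 (- v) s)).
    by apply/funext => s; exact: qformC_gexpo.
  exact: within_continuous4.
Qed.

(** * The delta conditions *)

Lemma gexp_linear_form {R : realType} {d} (A B C : 'M[R]_d) thx thy ze x y :
  gexp A B C thx thy ze x y =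
  expR (- qform C y / 2 + dotv thy y + ze) * expR (- qform A x / 2 + dotv (B *m y + thx) x).
Proof. by rewrite -expRD /gexp dotvDl (dotvC (B *m y)); congr expR; ring. Qed.

(** Gaussians are the test functions fed to the delta conditions; [D = 0] gives the constant 1. *)
Lemma continuous_gauss_test {R : realType} {d} (D : 'M[R]_d) :
  continuous (fun x : 'cV[R]_d => expR (- qform D x / 2)).
Proof.
move=> x'; set x : 'cV[R]_d := x'.
have FF : Filter (nbhs x) by exact: nbhs_filter.
have mx : mxcvg (nbhs x) id x by move=> i j; exact: coord_continuous.
have hq : - qform D z / 2 @[z --> x] --> - qform D x / 2.
  apply: cvgM; last exact: cvg_cst.
  by apply: cvgN; apply: cvg_dotv => //; apply: mxcvgM => //; exact: mxcvg_cst.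
by apply: (cvg_comp _ expR hq); exact: continuous_expR.
Qed.

(** Testing with the constant 1 at [y = 0], convergence to a finite value makes the Gaussian
    integral eventually finite, and finiteness forces positive definiteness. *)
Lemma delta_posdef {R : realType} {d} (F : set_system R) {FF : ProperFilter F}
  (A B C : R -> 'M[R]_d) (thx thy : R -> 'cV[R]_d) (ze : R -> R) :
  (\forall s \near F, symmx (A s)) ->
  (forall y (f : 'cV[R]_d -> R), continuous f -> (forall z, 0 <= f z) ->
    (exists M, forall z, f z <= M) ->
    (fun s => intRd (fun x =>
       (gexp (A s) (B s) (C s) (thx s) (thy s) (ze s) x y * f x)%:E)) @ F --> (f y)%:E) ->
  \forall s \near F, posdefmx (A s).
Proof.
move=> sA delta.
have h1 : (fun s => intRd (fun x =>
    (gexp (A s) (B s) (C s) (thx s) (thy s) (ze s) x 0 * 1)%:E)) @ F --> (1%:E : \bar R).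
  have c1 : continuous (fun _ : 'cV[R]_d => (1 : R)).
    have := continuous_gauss_test (0 : 'M[R]_d).
    by under eq_fun do rewrite /qform mul0mx dotv0r oppr0 mul0r expR0.
  by apply: (delta 0 (fun=> 1) c1) => //; exists 1.
have /fine_cvgP [nfin _] := h1.
near=> s; have sAs : symmx (A s) by near: s.
have : intRd (fun x => (gexp (A s) (B s) (C s) (thx s) (thy s) (ze s) x 0 * 1)%:E) \is a fin_num.
  by near: s.
rewrite fin_numElt => /andP[_].
under eq_fun => x do rewrite mulr1 gexp_linear_form.
by apply: intRd_finite_posdef => //; exact: expR_gt0.
Unshelve. all: by end_near. Qed.

(* The second difference in [y] of the logarithm of [int G_s(x|y) exp(-x^T D x / 2) dx] isolates the quadratic coefficient. *)
Lemma delta_cvg {R : realType} {d} (F : set_system R) {FF : ProperFilter F}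
  (A B C : R -> 'M[R]_d) (thx thy : R -> 'cV[R]_d) (ze : R -> R) :
  (\forall s \near F, symmx (A s)) ->
  (forall y (f : 'cV[R]_d -> R), continuous f -> (forall z, 0 <= f z) ->
    (exists M, forall z, f z <= M) ->
    (fun s => intRd (fun x =>
       (gexp (A s) (B s) (C s) (thx s) (thy s) (ze s) x y * f x)%:E)) @ F --> (f y)%:E) ->
  forall D, posdefmx D -> forall y,
  qform (C s) y - qform (invmx (A s + D)) (B s *m y) @[s --> F] --> qform D y.
Proof.
move=> sA delta D pD y; have nA : \forall s \near F, posdefmx (A s) by exact: delta_posdef delta.
(* The closed form of the integral of [G_s(x|y)] against the Gaussian test function, valid once
   [A s + D] is positive definite. *)
pose I s y := expR (- qform (C s) y / 2 + dotv (thy s) y + ze s) *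
  gauss_int (A s + D) (B s *m y + thx s).
have hI z : ln (I s z) @[s --> F] --> - qform D z / 2.
  rewrite -[X in _ --> X]expRK.
  apply: (cvg_comp _ (@ln R)); last by apply: continuous_ln; exact: expR_gt0.
  have h0 x : 0 <= expR (- qform D x / 2) by exact: expR_ge0.
  have h1 x : expR (- qform D x / 2) <= 1.
    rewrite -[X in _ <= X]expR0 ler_expR mulNr oppr_le0 divr_ge0 //.
    exact: posdef_ge0.
  have /fine_cvg := delta z _ (continuous_gauss_test D) h0 (ex_intro _ 1 h1).
  apply: cvg_trans; apply: near_eq_cvg; near=> s => /=.
  rewrite /I -[RHS]/(fine (_%:E)) -intRd_expquad; last 2 first.
  - exact: expR_ge0.
  - by apply: posdefD => //; near: s.
  congr (fine (intRd _)); apply/funext => x.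
  rewrite gexp_linear_form -mulrA -expRD qform_mxD; congr (_ * expR _)%:E.
  by field.
have hD : qform D y = - qform D 0 / 2 + - qform D 0 / 2 - (- qform D y / 2)
    - (- qform D (- y) / 2) by rewrite qform0 qformN; field.
have hln : ln (I s 0) + ln (I s 0) - ln (I s y) - ln (I s (- y)) @[s --> F] --> qform D y.
  by rewrite hD; apply: cvgB; [apply: cvgB; [apply: cvgD|]|]; exact: hI.
apply: cvg_trans hln; apply: near_eq_cvg; near=> s.
have pAs : posdefmx (A s + D).
  by apply: posdefD => //; near: s.
have lnI z : ln (I s z) = - qform (C s) z / 2 + dotv (thy s) z + ze s
    + (ln (Num.sqrt ((2 * pi) ^+ d / \det (A s + D)))
      + qform (invmx (A s + D)) (B s *m z + thx s) / 2).
  have q0 : 0 < Num.sqrt ((2 * pi) ^+ d / \det (A s + D)).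
    by rewrite sqrtr_gt0 divr_gt0 ?posdef_det // exprn_gt0 // mulr_gt0 ?pi_gt0.
  rewrite /I lnM ?posrE ?expR_gt0 ?gauss_int_gt0 // expRK; congr (_ + _).
  by rewrite /gauss_int lnM ?posrE ?expR_gt0 // expRK.
have sAi := symmx_inv _ pAs.1.
rewrite !lnI !qformN !qform0 !qformD // !mulmxN !qformN !mulmx0 !qform0 !dotvlin.
by field.
Unshelve. all: by end_near. Qed.

Lemma expquad_gauss_int {R : realType} {d} (A : 'M[R]_d) (b x : 'cV[R]_d) :
  posdefmx A ->
  expR (- qform A x / 2 + dotv b x) =
  gauss_int A b * gauss_pdf (invmx A *m b) (invmx A) x.
Proof.
move=> pA; have uA := posdef_unit _ pA; have dA := posdef_det _ pA.
have p0 : 0 < (2 * pi : R) ^+ d by rewrite exprn_gt0 // mulr_gt0 ?pi_gt0.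
rewrite /gauss_int /gauss_pdf invmxK det_inv mulrACA divff; last first.
  by rewrite gt_eqF // sqrtr_gt0 divr_gt0.
rewrite mul1r -expRD qformD; last exact: pA.1.
rewrite qformN qform_invmx // mulmxN mulKVmx // dotvNr (dotvC b).
by congr expR; field.
Qed.

(** * The mixture *)

Lemma derive_line {R : realType} {d} (f : 'cV[R]_d -> R) (x v : 'cV[R]_d) (df : R) :
  is_derive x v f df -> is_derive (0 : R) 1 (fun h : R => f (h *: v + x)) df.
Proof.
move=> [/derivable1P dg <-]; apply: DeriveDef => //; rewrite /derive.
rewrite (_ : (fun h : R => h^-1 *: (((fun r : R => f (r *: v + x)) \o shift 0)
    (h *: 1) - f (0 *: v + x))) = fun h => h^-1 *: ((f \o shift x) (h *: v) - f x)) //.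
by apply/funext => h /=; rewrite scale0r add0r addr0 [h *: 1]mulr1.
Qed.

(** The logarithmic gradient of a sum is the average of the components' logarithmic gradients,
    weighted by their shares of the sum. *)
Lemma grad_ln_mixture {R : realType} {d K} (om : 'I_K -> R) (L : 'I_K -> 'M[R]_d)
  (l : 'I_K -> 'cV[R]_d) (x : 'cV[R]_d) :
  let f k (x : 'cV[R]_d) := om k * expR (- qform (L k) x / 2 + dotv (l k) x) in
  let s x := \sum_k f k x in
  (forall k, symmx (L k)) -> 0 < s x ->
  (forall i, derivable (@ln R \o s) x (ebasis i)) /\
  grad (@ln R \o s) x = \sum_k (f k x / s x) *: (- (L k *m x) + l k).
Proof.
move=> f s sL s0.
(* Taking [B = C = 0] and [y = 0] makes each component a Green-type exponential, so its derivative
   is already computed. *)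
pose g k (x : 'cV[R]_d) := gexp (L k) 0 0 (l k) 0 0 x 0.
have fE k z : f k z = om k * g k z.
  rewrite /f /g /gexp; congr (_ * expR _).
  by rewrite !dotvlin !qform0; ring.
have dfk k v : is_derive (0 : R) 1 (fun h : R => f k (h *: v + x))
    (f k x * dotv v (- (L k *m x) + l k)).
  have := derive_line _ _ _ _ (is_derive_gexp (L k) 0 0 (l k) 0 0 x 0 v (sL k)).
  rewrite /ggrad mul0mx addr0 => hk.
  rewrite (_ : (fun h => _) = om k \*: (fun h : R => g k (h *: v + x))); last first.
    by apply/funext => h; rewrite fE.
  by apply: is_derive_eq; rewrite fE /GRing.scale /= mulrA.
have ds v : is_derive (0 : R) 1 (fun h : R => s (h *: v + x))
    (\sum_k f k x * dotv v (- (L k *m x) + l k)).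
  rewrite (_ : (fun h => _) = \sum_k (fun h : R => f k (h *: v + x))); last first.
    by apply/funext => h; rewrite fct_sumE.
  by apply: is_derive_sum.
have dln v : is_derive x v (@ln R \o s) (\sum_k f k x / s x * dotv v (- (L k *m x) + l k)).
  apply: is_derive_line.
  apply: (is_derive_ln (fun h : R => s (h *: v + x))); first by rewrite scale0r add0r.
  apply: is_derive_eq; rewrite scale0r add0r mulr_sumr; apply: eq_bigr => k _.
  by rewrite mulrA [s x * _]mulrC divfK // gt_eqF.
split=> [i|]; first by have [] := dln (ebasis i).
apply/matrixP => i j; rewrite ord1 mxE summxE.
rewrite (@derive_val _ _ _ _ _ _ _ (dln (ebasis i))).
by apply: eq_bigr => k _; rewrite dotv_ebasis [in RHS]mxE.
Qed.

(** The integration variable [y] is the second argument of [G-] but the first argument of [G+_T]: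
    hence [B^T x] in the linear term, and [Ap], [b], [z'] as coefficients of [log G+_T(y|x0)] in
    [y]. The powers of [2 pi] from the target density and from the integral cancel. *)
Lemma mixture_component {R : realType} {d} (A B C Ap Sig : 'M[R]_d)
  (thx thy b m : 'cV[R]_d) (ze z' p : R) (x : 'cV[R]_d) :
  let P := invmx Sig in
  let S := C + P - Ap in
  let q := thy + P *m m - b in
  let w := p * (Num.sqrt ((2 * pi) ^+ d * \det Sig))^-1 *
    expR (- qform P m / 2 - qform A x / 2 + dotv thx x + ze - z') in
  posdefmx Sig -> posdefmx S ->
  (forall y, p * gauss_pdf m Sig y * gexp A B C thx thy ze x y
     / expR (- qform Ap y / 2 + dotv b y + z') =
     w * expR (- qform S y / 2 + dotv (q + B^T *m x) y)) /\
  w * gauss_int S (q + B^T *m x) =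
    p * (Num.sqrt (\det Sig))^-1 * (Num.sqrt (\det S))^-1
    * expR (ze - z' - qform P m / 2 + qform (invmx S) q / 2)
    * expR (- qform (A - B *m invmx S *m B^T) x / 2
            + dotv (thx + B *m invmx S *m q) x).
Proof.
move=> P S q w pSig pS; have sP : symmx P := symmx_inv _ pSig.1.
have sSi := symmx_inv _ pS.1.
have dSig := posdef_det _ pSig; have dS := posdef_det _ pS.
have p0 : 0 < (2 * pi : R) ^+ d by rewrite exprn_gt0 // mulr_gt0 ?pi_gt0.
split=> [y|].
  rewrite /w /gauss_pdf -expRN /gexp -!mulrA; congr (_ * (_ * _)).
  rewrite -!expRD -/P qformD // qformN mulmxN dotvNr (dotv_sym P y m) //.
  rewrite /q /S !dotvlin !qform_mxD qform_mxN !dotv_mulmxl trmxK sP.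
  by congr expR; field.
rewrite /w /gauss_int sqrtrM ?(ltW p0) // (sqrtrM (\det S)^-1) ?(ltW p0) //.
rewrite sqrtrV ?(ltW dS) //.
have := sqrtr_gt0 ((2 * pi : R) ^+ d); rewrite p0.
set r := Num.sqrt ((2 * pi) ^+ d) => r0.
set s1 := Num.sqrt _; set s2 := Num.sqrt _.
transitivity (p * s1^-1 * s2^-1 * (expR (- qform P m / 2 - qform A x / 2 + dotv thx x + ze - z')
  * expR (qform (invmx S) (q + B^T *m x) / 2))).
  have s10 : s1 != 0 by rewrite gt_eqF // sqrtr_gt0.
  have s20 : s2 != 0 by rewrite gt_eqF // sqrtr_gt0.
  by field; rewrite s20 s10 gt_eqF.
rewrite -[RHS]mulrA -!expRD; congr (_ * expR _).
rewrite qformD // (qform_mxD A) qform_mxN dotvDl.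
have -> : qform (B *m invmx S *m B^T) x = qform (invmx S) (B^T *m x).
  by rewrite /qform -!mulmxA dotvC dotv_mulmxl dotvC.
rewrite -mulmxA dotv_mulmxl (dotvC (invmx S *m q)) (dotv_sym _ q (B^T *m x)) //.
by field.
Qed.

Lemma coupling_posdef {R : realType} {d} (Ap Am B C AT P : 'M[R]_d) :
  posdefmx (Ap + Am) -> symmx Ap -> symmx Am -> symmx C -> symmx AT -> posdefmx P ->
  (forall x y, qform AT y <= qform (Ap + Am) x - 2 * dotv x (B *m y) + qform C y) ->
  let S := C + P - AT in
  posdefmx S /\ posdefmx (Ap + (Am - B *m invmx S *m B^T)).
Proof.
move=> pM sAp sAm sC sAT pP hE S.
have sS : symmx S by apply: symmxD; [exact: symmxD sC pP.1|exact: symmxN].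
have qS y : qform S y = qform C y + qform P y - qform AT y.
  by rewrite /S !qform_mxD qform_mxN.
have pS : posdefmx S.
  (* The point [x = M^-1 B y], with [M = Ap + Am], minimises the right side of [hE] and gives
     [S >= P + B^T M^-1 B]. *)
  split=> // y y0; have := hE (invmx (Ap + Am) *m (B *m y)) y.
  rewrite qform_invmx ?posdef_unit // dotvC -/(qform _ (B *m y)) qS.
  by have := posdef_ge0 _ (B *m y) (posdef_inv _ pM); have := pP.2 _ y0; lra.
split=> //; have sSi := symmx_inv _ sS.
split.
  apply: symmxD => //; apply: symmxD => //; apply: symmxN.
  by rewrite /symmx !trmx_mul trmxK sSi mulmxA.
(* With this [y], [x^T Pi x = x^T M x - y^T S y], and [hE] at [(x, y)] bounds it below by [y^T P y].
   If [y = 0] the value is [x^T M x], positive by itself. *)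
move=> x x0; pose y := invmx S *m (B^T *m x).
have By : dotv x (B *m y) = qform S y.
  by rewrite /qform /y mulKVmx ?posdef_unit // dotvC dotv_mulmxl dotvC.
have -> : qform (Ap + (Am - B *m invmx S *m B^T)) x = qform (Ap + Am) x - qform S y.
  rewrite addrA [LHS]qform_mxD qform_mxN; congr (_ - _).
  by rewrite -By /y /qform -!mulmxA.
have := hE x y; rewrite By qS.
have [->|y0] := eqVneq y 0; last by have := pP.2 _ y0; lra.
by rewrite !qform0; have := pM.2 _ x0; lra.
Qed.

(** * The time grid and the assembly of the result *)

Lemma grid_locate {R : realType} (tg : nat -> R) (t : R) n :
  tg 0 <= t -> t < tg n -> exists2 j, (j < n)%N & tg j <= t < tg j.+1.
Proof.
elim: n => [|n IH] t0 tn; first by move: (lt_le_trans tn t0); rewrite ltxx.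
have [tgn|tgn] := leP (tg n) t; first by exists n => //; rewrite tgn.
by have [j jn hj] := IH t0 tgn; exists j => //; exact: ltnW.
Qed.

Lemma grid_mono {R : realType} (tg : nat -> R) N :
  (forall j, (j < N)%N -> tg j < tg j.+1) ->
  forall i j, (i <= j <= N)%N -> tg i <= tg j.
Proof.
move=> htg i; elim=> [|j IH]; first by rewrite leqn0 => /andP[/eqP ->].
rewrite leq_eqVlt => /andP[/orP[/eqP ->//|ij] jN].
by apply: le_trans (IH _) (ltW (htg j jN)); rewrite -ltnS ij ltnW.
Qed.

Theorem theorem1 (R : realType) (d : nat) (hd : (0 < d)%N)
  (T : R) (hT : 0 < T) (x0 : 'cV[R]_d)
  (* piecewise-constant protocol on the grid 0 = tg 0 < ... < tg N = T *)
  (N : nat) (tg : nat -> R) (htg0 : tg 0 = 0) (htgN : tg N = T)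
  (htg : forall j, (j < N)%N -> tg j < tg j.+1)
  (beta sigma : nat -> 'M[R]_d) (nu : nat -> 'cV[R]_d) (kappa : nat -> R)
  (hbeta : forall j, (j < N)%N -> posdefmx (beta j))
  (hkappa : forall j, (j < N)%N -> 0 < kappa j)
  (* Gaussian-mixture target *)
  (K : nat) (pk : 'I_K -> R) (m : 'I_K -> 'cV[R]_d) (Sig : 'I_K -> 'M[R]_d)
  (hpk : forall k, 0 < pk k) (hpk1 : \sum_(k < K) pk k = 1)
  (hSig : forall k, posdefmx (Sig k))
  (* coefficients of the Gaussian-exponential forms of G^(+) and G^(-) *)
  (Ap Bp Cp : R -> 'M[R]_d) (txp typ : R -> 'cV[R]_d) (zp : R -> R)
  (Am Bm Cm : R -> 'M[R]_d) (txm tym : R -> 'cV[R]_d) (zm : R -> R)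
  (hsymp : forall t, 0 < t <= T -> symmx (Ap t) /\ symmx (Cp t))
  (hsymm : forall t, 0 <= t < T -> symmx (Am t) /\ symmx (Cm t)) :
  let Gp := fun t x y => gexp (Ap t) (Bp t) (Cp t) (txp t) (typ t) (zp t) x y in
  let Gm := fun t x y => gexp (Am t) (Bm t) (Cm t) (txm t) (tym t) (zm t) x y in
  let V := fun j (x : 'cV[R]_d) => qform (beta j) (x - nu j) / 2 in
  (* G^(-) is the backward Green function *)
  (forall j, (j < N)%N -> forall t, tg j < t < tg j.+1 -> forall x y,
     derivable (fun s => Gm s x y) t 1 /\
     - 'D_1 (fun s => Gm s x y) t + V j x * Gm t x y
       = dotv (sigma j *m x) (grad (fun z => Gm t z y) x)
         + kappa j / 2 * lap (fun z => Gm t z y) x) ->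
  (forall x y, {within [set s | 0 <= s < T], continuous (fun s => Gm s x y)}) ->
  (forall y (f : 'cV[R]_d -> R), continuous f -> (forall z, 0 <= f z) ->
     (exists M, forall z, f z <= M) ->
     (fun t => intRd (fun x => (Gm t x y * f x)%:E)) @ at_left T --> (f y)%:E) ->
  (* G^(+) is the forward Green function *)
  (forall j, (j < N)%N -> forall t, tg j < t < tg j.+1 -> forall x y,
     derivable (fun s => Gp s x y) t 1 /\
     'D_1 (fun s => Gp s x y) t + V j x * Gp t x y
       = - divg (fun z => Gp t z y *: (sigma j *m z)) x
         + kappa j / 2 * lap (fun z => Gp t z y) x) ->
  (forall x y, {within [set s | 0 < s <= T], continuous (fun s => Gp s x y)}) ->
  (forall y (f : 'cV[R]_d -> R), continuous f -> (forall z, 0 <= f z) ->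
     (exists M, forall z, f z <= M) ->
     (fun t => intRd (fun x => (Gp t x y * f x)%:E)) @ at_right 0 --> (f y)%:E) ->
  let ptar := fun y => \sum_(k < K) pk k * gauss_pdf (m k) (Sig k) y in
  let psi := fun t x => intRd (fun y => (ptar y * Gm t x y / Gp T y x0)%:E) in
  let logpsi := fun t x => ln (fine (psi t x)) in
  let pstar := fun t x => Gp t x x0 * fine (psi t x)
                 / fine (intRd (fun z => (Gp t z x0 * fine (psi t z))%:E)) in
  let zpT := - qform (Cp T) x0 / 2 + dotv (typ T) x0 + zp T in
  let P := fun k => invmx (Sig k) in
  let S := fun k t => Cm t + P k - Ap T in
  let q := fun k t => tym t + P k *m m k - Bp T *m x0 - txp T in
  let Lam := fun k t => Am t - Bm t *m invmx (S k t) *m (Bm t)^T in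
  let lam := fun k t => txm t + Bm t *m invmx (S k t) *m q k t in
  let om := fun k t => pk k * (Num.sqrt (\det (Sig k)))^-1
              * (Num.sqrt (\det (S k t)))^-1
              * expR (zm t - zpT - qform (P k) (m k) / 2
                      + qform (invmx (S k t)) (q k t) / 2) in
  let psik := fun k t x => om k t * expR (- qform (Lam k t) x / 2 + dotv (lam k t) x) in
  let rho := fun k t x => psik k t x / \sum_(j < K) psik j t x in
  let Pi := fun k t => Ap t + Lam k t in
  let mu := fun k t => invmx (Pi k t) *m (Bp t *m x0 + txp t + lam k t) in
  let omt := fun k t => om k t * (Num.sqrt (\det (Pi k t)))^-1
               * expR (qform (Pi k t) (mu k t) / 2) in
  let pib := fun k t => omt k t / \sum_(j < K) omt j t in
  forall j, (j < N)%N -> forall t, tg j <= t < tg j.+1 -> 0 < t ->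
  forall x : 'cV[R]_d,
    (0 < psi t x < +oo)%E /\
    (forall i : 'I_d, derivable (logpsi t) x (ebasis i)) /\
    kappa j *: grad (logpsi t) x
      = kappa j *: \sum_(k < K) rho k t x *: (- (Lam k t *m x) + lam k t) /\
    pstar t x = \sum_(k < K) pib k t * gauss_pdf (mu k t) (invmx (Pi k t)) x.
Proof.
move=> Gp Gm V hGm cGm dGm hGp cGp dGp ptar psi logpsi pstar zpT P S q Lam lam
  om psik rho Pi mu omt pib j jN t tj t0 x.
have tg_ge0 i : (i <= N)%N -> 0 <= tg i.
  by move=> iN; rewrite -htg0; apply: (grid_mono tg N htg); rewrite iN.
have tg_leT i : (i <= N)%N -> tg i <= T.
  by move=> iN; rewrite -htgN; apply: (grid_mono tg N htg); rewrite iN leqnn.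
have tT : t < T by case/andP: tj => _ /lt_le_trans; apply; exact: tg_leT.
have t0T : 0 < t < T by rewrite t0.
pose E := [seq tg i | i <- iota 0 N.+1].
have [cAp _ _] := within_continuous_coeffs _ _ _ _ _ _ _ cGp.
have [cAm cBm cCm] := within_continuous_coeffs _ _ _ _ _ _ _ cGm.
have coupling : forall t, 0 < t < T -> [/\ posdefmx (Ap t), posdefmx (Am t) &
    forall x y, qform (Ap T) y <=
      qform (Ap t + Am t) x - 2 * dotv x (Bm t *m y) + qform (Cm t) y].
  apply: (riccati_coupling T E (fun i : 'I_N => beta i) (fun i => sigma i) (fun i => kappa i)
    Ap Am Bm Cm) => //.
  - by move=> i; apply: hbeta.
  - by move=> s /hsymp[].
  - by move=> s /hsymm[].
  - move=> s /andP[s0 sT] sE; have [||i iN /andP[is_ si]] := grid_locate tg s N.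
    + by rewrite htg0 ltW.
    + by rewrite htgN.
    (* Off the grid the half-open interval becomes open, which is where the Green equations hold. *)
    have tis : tg i < s < tg i.+1.
      rewrite si andbT lt_neqAle is_ andbT; apply: contra sE => /eqP <-.
      by apply: map_f; rewrite mem_iota /= add0n ltnS ltnW.
    exists (Ordinal iN).
    have [sAp _] : symmx (Ap s) /\ symmx (Cp s) by apply: hsymp; rewrite s0 ltW.
    have [sAm _] : symmx (Am s) /\ symmx (Cm s) by apply: hsymm; rewrite sT ltW.
    have [hA hB hC] := backward_riccati Am Bm Cm txm tym zm (beta i) (sigma i) (nu i) (kappa i) s
      sAm (hGm i iN s tis).
    split => //.
    exact: (forward_riccati Ap Bp Cp txp typ zp (beta i) (sigma i) (nu i) (kappa i) s
      sAp (hGp i iN s tis)).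
  - apply: delta_posdef dGm; near=> s.
    have [] : symmx (Am s) /\ symmx (Cm s) => //; apply: hsymm; apply/andP; split; last first.
      by near: s; exact: nbhs_left_lt.
    by near: s; exact: nbhs_left_ge.
  - apply: delta_posdef dGp; near=> s.
    have [] : symmx (Ap s) /\ symmx (Cp s) => //; apply: hsymp; apply/andP; split.
      by near: s; exact: nbhs_right_gt.
    by near: s; exact: nbhs_right_le.
  - apply: delta_cvg dGm; near=> s.
    have [] : symmx (Am s) /\ symmx (Cm s) => //; apply: hsymm; apply/andP; split; last first.
      by near: s; exact: nbhs_left_lt.
    by near: s; exact: nbhs_left_ge.
have [pAp pAm hE] := coupling t t0T.
have [sCm] : symmx (Cm t) /\ symmx (Ap T).
  by split; [apply: (hsymm t _).2; rewrite tT ltW|apply: (hsymp T _).1; rewrite hT lexx].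
move=> sApT.
have pSPi k : posdefmx (S k t) /\ posdefmx (Pi k t).
  apply: coupling_posdef => //; [exact: posdefD|exact: pAp.1|exact: pAm.1|exact: posdef_inv].
have pS k := (pSPi k).1; have pPi k := (pSPi k).2.
have sLam k : symmx (Lam k t).
  have := (pPi k).1; rewrite /Pi /symmx linearD /= pAp.1; exact: addrI.
have om0 k : 0 < om k t.
  by rewrite !mulr_gt0 ?expR_gt0 ?invr_gt0 ?sqrtr_gt0 ?posdef_det.
have K0 : (0 < K)%N.
  rewrite lt0n; apply/eqP => K0; move: hpk1; subst K; rewrite big_ord0 => /esym/eqP.
  by rewrite oner_eq0.
have sum_gt0 (f : 'I_K -> R) : (forall k, 0 < f k) -> 0 < \sum_(k < K) f k.
  move=> f0; rewrite (bigD1 (Ordinal K0)) //= ltr_wpDr ?f0 //.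
  by apply: sumr_ge0 => k _; exact: ltW.
have psiE z : psi t z = (\sum_(k < K) psik k t z)%:E.
  have GT y : Gp T y x0 =
      expR (- qform (Ap T) y / 2 + dotv (Bp T *m x0 + txp T) y + zpT).
    by rewrite /Gp /gexp /zpT dotvDl (dotvC (Bp T *m x0)); congr expR; ring.
  have comp k := mixture_component (Am t) (Bm t) (Cm t) (Ap T) (Sig k) (txm t) (tym t)
    (Bp T *m x0 + txp T) (m k) (zm t) zpT (pk k) z (hSig k) (pS k).
  have qE k : q k t = tym t + P k *m m k - (Bp T *m x0 + txp T).
    by rewrite /q opprD addrA.
  rewrite /psi (_ : (fun y => _) = fun y => (\sum_(k < K)
    (pk k * (Num.sqrt ((2 * pi) ^+ d * \det (Sig k)))^-1 *
     expR (- qform (P k) (m k) / 2 - qform (Am t) z / 2 + dotv (txm t) z + zm t - zpT)) *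
    expR (- qform (S k t) y / 2
      + dotv (tym t + P k *m m k - (Bp T *m x0 + txp T) + (Bm t)^T *m z) y))%:E); last first.
    have sumM (f : 'I_K -> R) u v : (\sum_k f k) * u / v = \sum_k f k * u / v.
      by rewrite !mulr_suml.
    apply/funext => y; rewrite /ptar sumM; congr EFin; apply: eq_bigr => k _.
    by rewrite GT; exact: ((comp k).1 y).
  rewrite intRd_sum_expquad //; last first.
    by move=> k; rewrite !mulr_ge0 ?expR_ge0 ?invr_ge0 ?sqrtr_ge0 // ltW.
  by congr EFin; apply: eq_bigr => k _; rewrite /psik /om /Lam /lam (qE k); exact: (comp k).2.
have psik0 k z : 0 < psik k t z by rewrite mulr_gt0 ?expR_gt0.
have [dlog glog] := grad_ln_mixture (fun k => om k t) (fun k => Lam k t) (fun k => lam k t) x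
  sLam (sum_gt0 _ (fun k => psik0 k x)).
have logE : logpsi t = @ln R \o (fun z => \sum_(k < K) psik k t z).
  by apply/funext => z; rewrite /logpsi psiE.
split; first by rewrite psiE lte_fin ltry sum_gt0.
split; first by rewrite logE.
split; first by rewrite logE glog.
pose b k := Bp t *m x0 + txp t + lam k t.
(* The factor of [G+_t(z|x0)] that does not depend on [z]; it cancels in the normalisation, as does
   [r] below. *)
pose c := expR (- qform (Cp t) x0 / 2 + dotv (typ t) x0 + zp t).
have GpsiE z : Gp t z x0 * fine (psi t z) =
    \sum_(k < K) c * om k t * expR (- qform (Pi k t) z / 2 + dotv (b k) z).
  rewrite psiE /Gp gexp_linear_form /= mulr_sumr; apply: eq_bigr => k _.
  rewrite -/c /psik mulrACA -expRD /Pi /b qform_mxD !dotvDl; congr (_ * expR _).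
  by field.
have c0 : 0 < c by exact: expR_gt0.
have intE : intRd (fun z => (Gp t z x0 * fine (psi t z))%:E) =
    (\sum_(k < K) c * om k t * gauss_int (Pi k t) (b k))%:E.
  rewrite (_ : (fun z => _) = fun z => (\sum_(k < K)
    c * om k t * expR (- qform (Pi k t) z / 2 + dotv (b k) z))%:E); last first.
    by apply/funext => z; congr EFin; exact: GpsiE.
  by apply: intRd_sum_expquad => // k; rewrite mulr_ge0 // ltW.
rewrite /pstar intE (GpsiE x).
set r := Num.sqrt ((2 * pi : R) ^+ d).
have p0 : 0 < (2 * pi : R) ^+ d by rewrite exprn_gt0 // mulr_gt0 ?pi_gt0.
have r0 : 0 < r by rewrite sqrtr_gt0.
(* [mu] is [Pi^-1 b], so the exponent [qform Pi mu] in [omt] equals the inverse form of [b] in the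
   Gaussian integral. *)
have gE k : c * om k t * gauss_int (Pi k t) (b k) = c * r * omt k t.
  rewrite /gauss_int sqrtrM ?(ltW p0) // sqrtrV ?(ltW (posdef_det _ (pPi k))) //.
  rewrite /omt /mu -/(b k) qform_invmx ?posdef_unit // -/r.
  by move: (om k t) (_^-1) (expR _) => u v w; ring.
have den : \sum_k c * om k t * gauss_int (Pi k t) (b k) = c * r * \sum_k omt k t.
  by rewrite mulr_sumr; apply: eq_bigr => k _; exact: gE.
have num : \sum_k c * om k t * expR (- qform (Pi k t) x / 2 + dotv (b k) x) =
    c * r * \sum_k omt k t * gauss_pdf (mu k t) (invmx (Pi k t)) x.
  rewrite mulr_sumr; apply: eq_bigr => k _.
  by rewrite (expquad_gauss_int _ (b k) x (pPi k)) mulrA gE mulrA.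
rewrite num den /= -mulf_div divff ?mul1r; last by rewrite gt_eqF ?mulr_gt0.
by rewrite mulr_suml; apply: eq_bigr => k _; rewrite /pib mulrAC.
Unshelve. all: by end_near. Qed.
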